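(* Let $u \in L^2(\mathbb{R})$ be such that $(-\Delta)^{1/2} u \in \mathcal{S}^*$. Then, in the sense of distributions, $$\frac{\mathrm{d}}{\mathrm{d}x}\mathcal{H}[u] = (-\Delta)^{1/2}[u].$$
   Context: $\mathcal{S}$ is the space of Schwartz functions on $\mathbb{R}$ and $\mathcal{S}^*$ its dual, the tempered distributions. The Hilbert transform $\mathcal{H}:L^p(\mathbb{R})\to L^p(\mathbb{R})$, $p\in(1,\infty)$, is $\mathcal{H}[u](x) = \frac{1}{\pi}\,\mathrm{p.v.}\!\int_{\mathbb{R}} \frac{u(y)}{x-y}\,\mathrm{d}y$ for a.e. $x$. For $\phi\in\mathcal{S}$, $(-\Delta)^{1/2}\phi(x) = c_{1/2}\,\mathrm{p.v.}\!\int_{\mathbb{R}} \frac{\phi(x)-\phi(y)}{|x-y|^{2}}\,\mathrm{d}y$, where $c_s = \frac{4^s\Gamma(1/2+s)}{\pi^{1/2}|\Gamma(-s)|}$. For $u\in L^2(\mathbb{R})$, $(-\Delta)^{1/2}u$ is defined by $\int_{\mathbb{R}} (-\Delta)^{1/2}[u]\,\phi\,\mathrm{d}x = \int_{\mathbb{R}} u\,(-\Delta)^{1/2}[\phi]\,\mathrm{d}x$ for all $\phi\in\mathcal{S}$. The derivative $\frac{\mathrm{d}}{\mathrm{d}x}$ is the distributional derivative. *)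

(* Defs.v *)
From HB Require Import structures.
From mathcomp Require Import all_boot all_order all_algebra.
From mathcomp Require Import all_classical all_reals all_analysis.
Set Implicit Arguments.
Unset Strict Implicit.
Unset Printing Implicit Defensive.
Import Order.TTheory GRing.Theory Num.Theory.
Import numFieldNormedType.Exports.
Local Open Scope classical_set_scope.
Local Open Scope ring_scope.

Section Defs.
Variable R : realType.
Implicit Types (u phi psi f : R -> R) (T : (R -> R) -> R).

Local Notation mu := (@lebesgue_measure R).

(* Principal value at [x]; the integrand itself may depend on [x].
   [lim] is total, with an arbitrary value when the limit does not exist. *)
Definition pv_integral (x : R) (g : R -> R) : R :=
  lim ((\int[mu]_(y in [set y | eps < `|x - y|]) g y) @[eps --> 0^'+]).

Definition hilbert_transform u (x : R) : R :=
  pi^-1 * pv_integral x (fun y => u y / (x - y)).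

Definition Euler_integral (z : R) : R :=
  \int[mu]_(t in `]0, +oo[) (t `^ (z - 1) * expR (- t)).

(* Extension of Euler's integral to the negative non-integers through
   Gamma(z) = Gamma(z + n) / (z (z + 1) ... (z + n - 1)), with n the least
   natural number such that 0 < z + n. *)
Definition Gamma (z : R) : R :=
  let n := if 0 < z then 0%N else (Num.truncn (- z)).+1 in
  Euler_integral (z + n%:R) / \prod_(k < n) (z + k%:R).

Definition fractional_const (s : R) : R :=
  4 `^ s * Gamma (2^-1 + s) / (pi `^ 2^-1 * `|Gamma (- s)|).

Definition half_laplacian phi (x : R) : R :=
  fractional_const 2^-1 *
  pv_integral x (fun y => (phi x - phi y) / `|x - y| ^+ 2).

Definition is_schwartz phi : Prop :=
  (forall n x, derivable (derive1n n phi) x 1) /\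
  (forall m n, exists C, forall x, `|x| ^+ m * `|derive1n n phi x| <= C).

Definition schwartz_seminorm (m n : nat) phi : R :=
  sup (range (fun x : R => `|x| ^+ m * `|derive1n n phi x|)).

Definition schwartz_cvg (phi_ : nat -> R -> R) phi : Prop :=
  forall m n, schwartz_seminorm m n (phi_ k \- phi) @[k --> \oo] --> (0 : R).

(* A tempered distribution is represented by a functional on all of [R -> R],
   of which only the restriction to Schwartz functions is meaningful.
   Sequential continuity suffices, the Schwartz space being metrizable. *)
Definition is_tempered_distribution T : Prop :=
  [/\ forall (a : R) phi psi, is_schwartz phi -> is_schwartz psi ->
        T (fun x => a * phi x + psi x) = a * T phi + T psi
    & forall (phi_ : nat -> R -> R) phi, (forall k, is_schwartz (phi_ k)) -> is_schwartz phi ->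
        schwartz_cvg phi_ phi -> T (phi_ k) @[k --> \oo] --> T phi].

Definition distribution_eq T1 T2 : Prop :=
  forall phi, is_schwartz phi -> T1 phi = T2 phi.

Definition distribution_of f : (R -> R) -> R :=
  fun phi => \int[mu]_x (f x * phi x).

Definition distribution_derive T : (R -> R) -> R :=
  fun phi => - T (derive1 phi).

Definition half_laplacian_distribution u : (R -> R) -> R :=
  fun phi => \int[mu]_x (u x * half_laplacian phi x).

End Defs.

(* Main.v *)
(* Write [q_e(t) = t / (t^2 + e^2)] and [p_e(t) = e / (t^2 + e^2)] for the conjugate
   Poisson and Poisson kernels (without the factor [1/pi]), and [Q_e], [P_e] for the
   corresponding convolution operators.

   The identities [P_e Q_d = pi Q_(e+d)] and [Q_e Q_d = - pi P_(e+d)] show that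
   [e |-> |Q_e f|_2^2] is nonincreasing, is bounded by [pi^2 |f|_2^2], and that
   [|Q_e f - Q_d f|_2^2] is a second difference of this function; hence [Q_e f] converges
   in [L^2] to some [g] as [e -> 0], and [pi Q_e f = P_e g].  The truncated kernel
   [1/t 1_(|t| > e)] differs from [q_e] by an odd kernel dominated by [p_e], so at the
   common Lebesgue points of [f] and [g] the truncated Hilbert integrals of [f] converge
   to [g]: the principal value exists almost everywhere and [H f = g / pi].

   As the operators [Q_e] are antisymmetric, so is [H].  An integration by parts in the
   truncated integrals gives [(-Delta)^(1/2) phi = H phi'] almost everywhere, and
   [- <H u, phi'> = <u, H phi'>] is the theorem. *)

Require Import Defs.
From HB Require Import structures.
From mathcomp Require Import all_boot all_order all_algebra.
From mathcomp Require Import all_classical all_reals all_analysis.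
From mathcomp Require Import measurable_realfun ring lra.
Set Implicit Arguments.
Unset Strict Implicit.
Unset Printing Implicit Defensive.
Import Order.TTheory GRing.Theory Num.Theory.
Import numFieldNormedType.Exports.
Local Open Scope classical_set_scope.
Local Open Scope ring_scope.

(** * Square-integrable functions *)

(** The conjugate Poisson kernel is square-integrable but not integrable. So Q_e f has a value at
    every point for f in L^2, and the kernel identities hold pointwise, but exchanging two integrals
    which both carry such a kernel requires an integrable factor. The estimates are therefore proved
    for f both integrable and square-integrable, then extended by truncation to segments; this works
    because the bound pi^2 is uniform in e. The second difference comes from <Q_e f, Q_d f> = pi <f,
    P_(e+d) f>, which depends on e + d only and hence equals |Q_m f|_2^2 with m = (e + d) / 2.
    Monotonicity and boundedness then yield the Cauchy property with no Fourier transform. The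
    principal values are total functions controlled only almost everywhere, so integrands are
    exchanged up to null sets with no measurability at hand. The constants match because c_(1/2) = 2
    Gamma(1) / (sqrt pi |Gamma(-1/2)|) = 1 / pi is the factor of the Hilbert transform. *)

Lemma cvg_sqr {R : realType} {T : Type} {F : set_system T} {FF : Filter F} (f : T -> R) (l : R) :
  f x @[x --> F] --> l -> (f x ^+ 2) @[x --> F] --> l ^+ 2.
Proof. by move=> fl; rewrite expr2; under eq_cvg do rewrite expr2; exact: cvgM. Qed.

Section integration.
Context d {T : measurableType d} {R : realType} (mu : {measure set T -> \bar R}).
Implicit Types f g h : T -> R.
Local Notation intg f := (mu.-integrable [set: T] (EFin \o f)).

Lemma le_integrableT f g : measurable_fun [set: T] f ->
  (forall x, `|f x| <= g x) -> intg g -> intg f.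
Proof.
move=> mf fg; apply: le_integrable => //; first exact/measurable_EFinP.
by move=> x _ /=; rewrite lee_fin (le_trans (fg x))// ler_norm.
Qed.

Lemma integrable_measurable f : intg f -> measurable_fun [set: T] f.
Proof. by move=> /measurable_int/measurable_EFinP. Qed.

Lemma integrableDT f g : intg f -> intg g -> intg (fun x => f x + g x).
Proof. exact: integrableD. Qed.

Lemma integrableBT f g : intg f -> intg g -> intg (fun x => f x - g x).
Proof. exact: integrableB. Qed.

Lemma integrableZT k f : intg f -> intg (fun x => k * f x).
Proof. exact: integrableZl. Qed.

Lemma integrable_normT f : intg f -> intg (fun x => `|f x|).
Proof. exact: integrable_norm. Qed.

Import HBNNSimple.

Lemma integrable_mul_bounded f g (C : R) : intg f -> measurable_fun [set: T] g ->
  (forall x, `|g x| <= C) -> intg (fun x => f x * g x).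
Proof.
move=> fi mg gC; apply: le_integrableT (integrableZT C (integrable_normT fi)).
  by apply: measurable_funM => //; exact: integrable_measurable.
by move=> x; rewrite normrM mulrC ler_wpM2r.
Qed.

(* Lebesgue integrals are suprema over simple functions, so a null set does not matter even
   for nonmeasurable integrands, such as a total principal value which takes junk values
   where the limit does not exist. *)
Lemma ae_eq_integral_nonmeasurable (f g : T -> \bar R) :
  {ae mu, forall x, f x = g x} -> (\int[mu]_x f x = \int[mu]_x g x)%E.
Proof.
suff le (h k : T -> \bar R) : (forall x, 0 <= h x)%E -> (forall x, 0 <= k x)%E ->
    {ae mu, forall x, h x = k x} -> (\int[mu]_x h x <= \int[mu]_x k x)%E.
  move=> fg; rewrite integralE [RHS]integralE; congr (_ - _)%E.
    apply/eqP; rewrite eq_le !le//; move: fg; apply: filterS => x xe;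
    by rewrite !funeposE xe.
  apply/eqP; rewrite eq_le !le//; move: fg; apply: filterS => x xe;
  by rewrite !funenegE xe.
move=> h0 k0 [N [mN N0 sN]].
rewrite ge0_integralTE// ge_ereal_sup// => _ [s /= hs <-].
have mN' : measurable (~` N) by exact: measurableC.
rewrite -integralT_nnsfun.
(* Cutting [s] off on [N] leaves its integral unchanged and places it below [k] everywhere. *)
have -> : (\int[mu]_x (s x)%:E = \int[mu]_x (proj_nnsfun s mN' x)%:E)%E.
  apply: ae_eq_integral => //; [exact/measurable_EFinP|exact/measurable_EFinP|].
  exists N; split => // x /=; apply: contra_notP => xN _; rewrite mindicE mem_set//=.
  by rewrite mulr1.
rewrite ge0_integralTE; last by move=> x; rewrite lee_fin.
rewrite [leRHS]ge0_integralTE//.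
rewrite ge_ereal_sup// => _ [t /= ht <-]; apply: ereal_sup_ubound; exists t => //= x.
apply: (le_trans (ht x)) => /=; rewrite mindicE.
have [xN|xN] := boolP (x \in ~` N); last by rewrite mulr0.
rewrite mulr1; have -> : k x = h x; last exact: hs.
by move: xN; rewrite inE => xN; apply: contrapT => /nesym hk; apply: xN; exact: sN.
Qed.

Lemma ae_eq_Rintegral f g : {ae mu, forall x, f x = g x} ->
  \int[mu]_x f x = \int[mu]_x g x.
Proof.
move=> fg; congr fine; apply: ae_eq_integral_nonmeasurable.
by move: fg; apply: filterS => x ->.
Qed.

Lemma aeS (P Q : T -> Prop) : (forall x, P x -> Q x) ->
  {ae mu, forall x, P x} -> {ae mu, forall x, Q x}.
Proof. by move=> PQ; apply: filterS. Qed.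

Lemma aeS2 (P Q S : T -> Prop) : (forall x, P x -> Q x -> S x) ->
  {ae mu, forall x, P x} -> {ae mu, forall x, Q x} -> {ae mu, forall x, S x}.
Proof. by move=> PQS; apply: filterS2. Qed.

(** Negation exchanges the positive and negative parts. When one of them has an infinite integral,
    [fine] sends both sides to 0. *)
Lemma RintegralNT f : \int[mu]_x (- f x) = - \int[mu]_x f x.
Proof.
rewrite /Rintegral integralE [in RHS]integralE.
have -> : (fun x => (- f x)%:E) = (\- (EFin \o f))%E by [].
rewrite funeposN funenegN.
have : (0 <= \int[mu]_x ((EFin \o f)^\+ x))%E by apply: integral_ge0.
have : (0 <= \int[mu]_x ((EFin \o f)^\- x))%E by apply: integral_ge0.
by case: (integral _ _ _) => [r| |]//; case: (integral _ _ _) => [s| |]//= _ _; rewrite ?opprB ?oppr0.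
Qed.

(** Fatou's lemma for real integrals: a bound along the sequence yields both the integrability of
    the limit and the same bound for it. *)
Lemma integrable_le_fatou (f_ : nat -> T -> R) f (C : R) :
  (forall n, intg (f_ n)) -> (forall n x, 0 <= f_ n x) ->
  (forall x, f_ n x @[n --> \oo] --> f x) ->
  (\forall n \near \oo, \int[mu]_x f_ n x <= C) ->
  intg f /\ \int[mu]_x f x <= C.
Proof.
move=> if_ f_0 ff_ leC.
have mf : measurable_fun [set: T] f.
  by apply: (@measurable_fun_cvg _ _ _ _ f_) => // n; exact: integrable_measurable.
have f0 x : 0 <= f x.
  by apply: (cvgr_to_ge (ff_ x)); exact: nearW.
have le : (\int[mu]_x (f x)%:E <= C%:E)%E.
  have := @fatou _ _ _ mu setT measurableT (fun n x => (f_ n x)%:E).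
  have mf_ n : measurable_fun setT (EFin \o f_ n) by exact: measurable_int (if_ n).
  move=> /(_ mf_); move=> /(_ (fun n x _ => f_0 n x)) fat.
  have -> : (\int[mu]_x (f x)%:E = \int[mu]_x limn_einf (fun n => (f_ n x)%:E))%E.
    apply: eq_integral => x _; apply/esym.
    have c : (f_ n x)%:E @[n --> \oo] --> (f x)%:E by apply: cvg_EFin; [exact: nearW|exact: ff_].
    by have [-> _] := cvg_limn_einf_sup c.
  apply: (le_trans fat).
  rewrite limn_einf_lim; apply: lime_le; first exact: is_cvg_einfs.
  move: leC; apply: filterS => n le_n.
  apply: (@le_trans _ _ (\int[mu]_x (f_ n x)%:E)%E).
    by apply: ereal_inf_lbound; exists n => /=.
  by rewrite -[leLHS]fineK ?lee_fin; [exact: le_n|exact/integrable_fin_num/if_].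
have fin : intg f.
  apply/integrableP; split; first exact/measurable_EFinP.
  under eq_integral do rewrite /= ger0_norm//.
  by rewrite (le_lt_trans le)// ltry.
split => //; rewrite -lee_fin fineK//; exact: integrable_fin_num.
Qed.

(** Functions rather than classes modulo null sets, because the identities between Poisson integrals
    are used at every point. *)
Definition L2 f := measurable_fun [set: T] f /\ intg (fun x => f x ^+ 2).

Lemma L2_integrableM f g : L2 f -> L2 g -> intg (fun x => f x * g x).
Proof.
move=> [mf f2] [mg g2]; apply: le_integrableT (integrableDT f2 g2).
  exact: measurable_funM.
by move=> x; rewrite ler_norml; apply/andP; split; nra.
Qed.

Lemma L2D f g : L2 f -> L2 g -> L2 (fun x => f x + g x).
Proof.
move=> Lf Lg; split; first exact: measurable_funD Lf.1 Lg.1.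
have := integrableDT (integrableDT Lf.2 Lg.2) (integrableZT 2 (L2_integrableM Lf Lg)).
by congr (mu.-integrable _ _); apply/funext => x /=; congr EFin; ring.
Qed.

Lemma L2Z k f : L2 f -> L2 (fun x => k * f x).
Proof.
move=> Lf; split; first exact: measurable_funM Lf.1.
have := integrableZT (k ^+ 2) Lf.2.
by congr (mu.-integrable _ _); apply/funext => x /=; congr EFin; ring.
Qed.

Lemma L2B f g : L2 f -> L2 g -> L2 (fun x => f x - g x).
Proof.
move=> Lf /(L2Z (-1)) /(L2D Lf).
by congr L2; apply/funext => x; ring.
Qed.

Lemma le_L2 f g : measurable_fun [set: T] f -> (forall x, `|f x| <= `|g x|) -> L2 g -> L2 f.
Proof.
move=> mf fg [mg g2]; split => //; apply: le_integrableT g2; first exact: measurable_funX.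
move=> x; rewrite ger0_norm ?sqr_ge0// -(real_normK (num_real (f x))).
by rewrite -(real_normK (num_real (g x))) ler_sqr ?nnegrE.
Qed.

Lemma RintegralDT f g : intg f -> intg g ->
  \int[mu]_x (f x + g x) = \int[mu]_x f x + \int[mu]_x g x.
Proof. exact: RintegralD. Qed.

Lemma RintegralBT f g : intg f -> intg g ->
  \int[mu]_x (f x - g x) = \int[mu]_x f x - \int[mu]_x g x.
Proof. exact: RintegralB. Qed.

Lemma RintegralZT k f : intg f -> \int[mu]_x (k * f x) = k * \int[mu]_x f x.
Proof. by move=> ?; rewrite RintegralZl. Qed.

Lemma le_RintegralT f g : intg f -> intg g -> (forall x, f x <= g x) ->
  \int[mu]_x f x <= \int[mu]_x g x.
Proof. by move=> ? ? fg; exact: le_Rintegral. Qed.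

Lemma discriminant_le (A B C : R) : 0 <= C ->
  (forall t, 0 <= A - 2 * t * B + t ^+ 2 * C) -> B ^+ 2 <= A * C.
Proof.
move=> C0 quad.
have [C_eq0|C_neq0] := eqVneq C 0; last first.
  have Cp : 0 < C by rewrite lt0r C_neq0.
  have := quad (B / C); rewrite -(pmulr_rge0 _ Cp) => h.
  rewrite -subr_ge0; apply: le_trans h _; rewrite le_eqVlt; apply/orP; left; apply/eqP.
  by field.
rewrite C_eq0 mulr0.
have [->|B0] := eqVneq B 0; first by rewrite expr0n.
(* With [C = 0] the expression is affine in [t], and this [t] gives it the value -1. *)
have := quad ((A + 1) / (2 * B)); rewrite C_eq0 mulr0 addr0.
have -> : 2 * ((A + 1) / (2 * B)) * B = A + 1 by field.
by rewrite opprD addNKr ler0N1.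
Qed.

(** The integral of w (f - t g)^2 is nonnegative for all t. The weight will be |f|, paired with the
    sign of f, or a Poisson kernel, paired with the constant 1; the latter case is Jensen's
    inequality. *)
Lemma weighted_Cauchy_Schwarz w f g : (forall x, 0 <= w x) ->
  intg (fun x => w x * f x ^+ 2) -> intg (fun x => w x * g x ^+ 2) ->
  intg (fun x => w x * (f x * g x)) ->
  (\int[mu]_x (w x * (f x * g x))) ^+ 2 <=
  \int[mu]_x (w x * f x ^+ 2) * \int[mu]_x (w x * g x ^+ 2).
Proof.
move=> w0 wf wg wfg; apply: discriminant_le.
  by apply: Rintegral_ge0 => x _; rewrite mulr_ge0 ?sqr_ge0.
move=> t.
rewrite -!RintegralZT// -RintegralBT//; last exact: integrableZT.
rewrite -RintegralDT//; last 2 first.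
- by apply: integrableBT => //; exact: integrableZT.
- exact: integrableZT.
rewrite (@eq_Rintegral _ _ _ _ _ (fun x => w x * (f x - t * g x) ^+ 2)); last first.
  by move=> x _; ring.
by apply: Rintegral_ge0 => x _; rewrite mulr_ge0 ?sqr_ge0.
Qed.

Lemma Cauchy_Schwarz f g : L2 f -> L2 g ->
  (\int[mu]_x (f x * g x)) ^+ 2 <= \int[mu]_x (f x ^+ 2) * \int[mu]_x (g x ^+ 2).
Proof.
move=> Lf Lg; have := @weighted_Cauchy_Schwarz (fun=> 1) f g (fun=> ler01).
have e h : (fun x => 1 * h x) = h by apply/funext => x; rewrite mul1r.
by rewrite !e; apply; [exact: Lf.2|exact: Lg.2|exact: L2_integrableM].
Qed.

Lemma L2_cvg_inner (h : nat -> T -> R) f g : (forall n, L2 (h n)) -> L2 f -> L2 g ->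
  \int[mu]_x ((h n x - g x) ^+ 2) @[n --> \oo] --> 0 ->
  \int[mu]_x (f x * h n x) @[n --> \oo] --> \int[mu]_x (f x * g x).
Proof.
move=> Lh Lf Lg hg.
set F := \int[mu]_x (f x ^+ 2).
have F0 : 0 <= F by apply: Rintegral_ge0 => x _; exact: sqr_ge0.
apply/cvgrPdist_lt => e e0.
(* [F + 1] instead of [F] covers the case [F = 0]. *)
have d0 : 0 < e ^+ 2 / (F + 1) by rewrite divr_gt0// ?exprn_gt0// ltr_pwDr.
move/cvgrPdist_lt : hg => /(_ _ d0); apply: filterS => n.
rewrite sub0r normrN ger0_norm; last by apply: Rintegral_ge0 => x _; exact: sqr_ge0.
rewrite ltr_pdivlMr ?ltr_pwDr// => hn.
rewrite -RintegralBT; [|exact: L2_integrableM..].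
rewrite -(@ltr_pXn2r _ 2)// ?nnegrE ?(ltW e0)// real_normK ?num_real//.
apply: le_lt_trans hn.
have -> : \int[mu]_x (f x * g x - f x * h n x) = \int[mu]_x (f x * (g x - h n x)).
  by apply: eq_Rintegral => x _; ring.
apply: le_trans (Cauchy_Schwarz Lf (L2B Lg (Lh n))) _.
rewrite -/F mulrC.
under eq_Rintegral do rewrite -sqrrN opprB.
by rewrite ler_wpM2l ?lerDl// Rintegral_ge0// => x _; exact: sqr_ge0.
Qed.

(** Riesz-Fischer: a fast subsequence converges off a null set, and Fatou's lemma along it carries
    the Cauchy bound of the whole sequence over to the limit. *)
Lemma L2_complete (h : nat -> T -> R) : (forall n, L2 (h n)) ->
  (forall e, 0 < e -> exists N, forall m n, (N <= m)%N -> (N <= n)%N ->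
     \int[mu]_x ((h m x - h n x) ^+ 2) <= e) ->
  exists2 g, L2 g & \int[mu]_x ((h n x - g x) ^+ 2) @[n --> \oo] --> 0.
Proof.
move=> Lh hC.
have /choice[N0 N0P] : forall k, exists N0, forall m n, (N0 <= m)%N -> (N0 <= n)%N ->
    \int[mu]_x ((h m x - h n x) ^+ 2) <= (1 / 4) ^+ k.
  by move=> k; apply: hC; rewrite exprn_gt0// divr_gt0.
(* Summing all earlier thresholds makes [N] nondecreasing and at least [N0]; the summand [k] makes
   it tend to infinity. *)
pose N k := (k + \sum_(i < k.+1) N0 i)%N.
have NN0 k : (N0 k <= N k)%N by rewrite /N big_ord_recr/= addnA leq_addl.
have NS k : (N k <= N k.+1)%N by rewrite /N; apply: leq_add => //; rewrite [leqRHS]big_ord_recr/= leq_addr.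
pose dl k x := h (N k.+1) x - h (N k) x.
have Ld k : L2 (dl k) by exact: L2B.
have dP k : \int[mu]_x (dl k x ^+ 2) <= (1 / 4) ^+ k.
  by apply: N0P => //; apply: leq_trans (NS k).
(* [|d_k| <= 2^-k + 2^k d_k^2] and the series [2^k d_k^2] has a finite integral, so that
   the fast subsequence converges absolutely almost everywhere *)
pose s k x := 2 ^+ k * dl k x ^+ 2.
have is_ k : intg (s k) by exact: integrableZT (Ld k).2.
have s0 k x : 0 <= s k x by rewrite mulr_ge0// sqr_ge0.
have Rs k : \int[mu]_x s k x <= (1 / 2) ^+ k.
  rewrite RintegralZT; last exact: (Ld k).2.
  apply: le_trans (ler_wpM2l _ (dP k)) _; first by rewrite exprn_ge0.
  by rewrite -exprMn (_ : 2 * (1 / 4) = 1 / 2 :> R)//; field.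
have geo n : \sum_(0 <= k < n) ((1 / 2) ^+ k : R) <= 2.
  have : \sum_(0 <= k < n) ((1 / 2) ^+ k : R) = 2 - 2 * (1 / 2) ^+ n.
    elim: n => [|n ih]; first by rewrite big_nil expr0; ring.
    by rewrite big_nat_recr//= ih exprS; field.
  by move=> ->; rewrite gerBl mulr_ge0// exprn_ge0// divr_ge0.
pose S x := (\sum_(k <oo) (s k x)%:E)%E.
have S0 x : (0 <= S x)%E by apply: nneseries_ge0 => k _ _; rewrite lee_fin.
have ms k : measurable_fun [set: T] (EFin \o s k) by exact: measurable_int (is_ k).
have iS : (\int[mu]_x S x <= 2%:E)%E.
  rewrite integral_nneseries//; last by move=> k x _; rewrite lee_fin.
  apply: lime_le; first by apply: is_cvg_nneseries => k _ _; apply: integral_ge0 => x _; rewrite lee_fin.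
  apply: nearW => n.
  rewrite (eq_bigr (fun k => (\int[mu]_x s k x)%:E)); last first.
    by move=> k _; rewrite fineK//; exact: integrable_fin_num (is_ k).
  by rewrite sumEFin lee_fin; apply: le_trans (geo n); apply: ler_sum => k _.
have intS : mu.-integrable setT S.
  apply/integrableP; split.
    apply: (@ge0_emeasurable_sum _ _ _ _ (fun k x => (s k x)%:E) xpredT).
      by move=> k x _ _; rewrite lee_fin.
    by move=> k _; exact: ms.
  rewrite (eq_integral S); last by move=> x _; rewrite gee0_abs.
  by rewrite (le_lt_trans iS)// ltry.
have [Z [mZ Z0 ZP]] := integrable_ae measurableT intS.
have finS x : ~ Z x -> S x \is a fin_num by move=> Zx; apply: contrapT => h1; apply: Zx; apply: ZP => /= /(_ I).
(* Setting the functions to 0 on the null set [Z], where the series is infinite, makes the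
   subsequence converge at every point. *)
pose h' n x := h (N n) x * \1_(~` Z) x.
have cvgh' x : cvgn (fun n => h' n x).
  rewrite /h' indicE; have [Zx|Zx] := boolP (x \in ~` Z); last first.
    by under eq_fun do rewrite mulr0; exact: is_cvg_cst.
  under eq_fun do rewrite mulr1.
  have {}Zx : S x \is a fin_num by apply: finS; move: Zx; rewrite inE.
  suff : cvgn (series (fun k => dl k x)).
    move=> cd.
    rewrite (_ : (fun n => _) = (fun n => h (N 0%N) x + series (fun k => dl k x) n)).
      by apply: is_cvgD => //; exact: is_cvg_cst.
    apply/funext => n; rewrite /series/= telescope_sumr//; ring.
  apply: normed_cvg; apply: nondecreasing_is_cvgn.
    by apply: nondecreasing_series => k _ _; exact: normr_ge0.
  exists (2 + fine (S x)) => _ [n _ <-].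
  apply: (@le_trans _ _ (\sum_(0 <= k < n) ((1 / 2) ^+ k + s k x))).
    apply: ler_sum => k _; rewrite /s /=.
    have a0 : 0 < 2 ^+ k :> R by rewrite exprn_gt0.
    rewrite expr_div_n expr1n -(real_normK (num_real (dl k x))).
    move: a0 (normr_ge0 (dl k x)); set a := 2 ^+ k; set b := `|dl k x| => a0 b0.
    rewrite -subr_ge0 (_ : _ - _ = ((a * b - 1) ^+ 2 + a * b) / a); last by field; rewrite gt_eqF.
    by rewrite divr_ge0 ?addr_ge0 ?sqr_ge0 ?mulr_ge0// ltW.
  rewrite big_split/= lerD// -lee_fin fineK// -sumEFin.
  by apply: nneseries_lim_ge => k _ _; rewrite lee_fin.
pose g x := limn (fun n => h' n x).
have Lh' n : L2 (fun x => h n x * \1_(~` Z) x).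
  apply: le_L2 (Lh n); first by apply: measurable_funM; [exact: (Lh _).1|apply: measurable_indic; exact: measurableC].
  by move=> x; rewrite normrM indicE; case: (_ \in _); rewrite ?normr1 ?normr0 ?mulr1// mulr0.
have mg : measurable_fun [set: T] g.
  apply: (@measurable_fun_cvg _ _ _ _ h'); first by move=> n; exact: (Lh' _).1.
  by move=> x _; exact: cvgh'.
(* Fatou's lemma in [m] with [n] fixed. *)
have key n (e : R) : (forall m, (n <= m)%N -> \int[mu]_x ((h n x - h m x) ^+ 2) <= e) ->
    intg (fun x => (h n x * \1_(~` Z) x - g x) ^+ 2) /\
    \int[mu]_x ((h n x * \1_(~` Z) x - g x) ^+ 2) <= e.
  move=> hn; apply: (@integrable_le_fatou (fun m x => (h n x * \1_(~` Z) x - h' m x) ^+ 2)).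
  - by move=> m; exact: (L2B (Lh' _) (Lh' _)).2.
  - by move=> m x; exact: sqr_ge0.
  - by move=> x; apply: cvg_sqr; apply: cvgB; [exact: cvg_cst|exact: cvgh'].
  - near=> m; apply: le_trans (hn (N m) _); last first.
      by apply: leq_trans (leq_addr _ _); near: m; exact: nbhs_infty_ge.
    apply: le_RintegralT; [exact: (L2B (Lh' _) (Lh' _)).2|exact: (L2B (Lh _) (Lh _)).2|].
    move=> x; rewrite /h' indicE; case: (_ \in _); rewrite ?mulr1// !mulr0 subr0 expr0n.
    exact: sqr_ge0.
have aeZ : {ae mu, forall x, ~ Z x} by exists Z; split => // x /= /contrapT.
have Lg : L2 g.
  have [n hn] := hC 1 ltr01.
  have [k1 _] := key n 1 (fun m nm => hn n m (leqnn n) nm).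
  have : L2 (fun x => h n x * \1_(~` Z) x - (h n x * \1_(~` Z) x - g x)).
    apply: (L2B (Lh' n)); split => //.
    exact: measurable_funB (Lh' n).1 mg.
  by congr L2; apply/funext => x; ring.
exists g => //; apply/cvgrPdist_le => e e0.
have [n hn] := hC e e0; near=> m.
rewrite sub0r normrN ger0_norm; last by apply: Rintegral_ge0 => x _; exact: sqr_ge0.
have nm : (n <= m)%N by near: m; exact: nbhs_infty_ge.
have [_] := key m e (fun p mp => hn m p nm (leq_trans nm mp)).
rewrite (@ae_eq_Rintegral _ (fun x => (h m x - g x) ^+ 2))//.
move: aeZ; apply: filterS => x Zx; rewrite indicE mem_set// mulr1//.
Unshelve. all: by end_near. Qed.
End integration.

(** * Dominated convergence and exhaustion *)

Section dominated.
Context d {T : measurableType d} {R : realType} (mu : {measure set T -> \bar R}).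
Implicit Types f g h : T -> R.
Local Notation intg f := (mu.-integrable [set: T] (EFin \o f)).

Lemma cvg_Rintegral_dominated (f_ : nat -> T -> R) f g :
  (forall n, measurable_fun [set: T] (f_ n)) ->
  (forall x, f_ n x @[n --> \oo] --> f x) ->
  intg g -> (forall n x, `|f_ n x| <= g x) ->
  intg f /\ \int[mu]_x f_ n x @[n --> \oo] --> \int[mu]_x f x.
Proof.
move=> mf_ ff_ ig fg.
have mf : measurable_fun [set: T] f by exact: (@measurable_fun_cvg _ _ _ _ f_).
have [] := @dominated_convergence _ T R mu setT measurableT (fun n => EFin \o f_ n) (EFin \o f) (EFin \o g).
- by move=> n; exact/measurable_EFinP.
- exact/measurable_EFinP.
- by apply: aeW => x _; apply: cvg_EFin; [exact: nearW|exact: ff_].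
- exact: ig.
- by apply: aeW => x n _; rewrite /= lee_fin.
move=> i1 _ c; split => //.
by apply: fine_cvg; rewrite fineK//; exact: integrable_fin_num i1.
Qed.

(** Dominated convergence for the restrictions of [f] to the sets [A n], with dominating function
    |f|. *)
Lemma cvg_Rintegral_exhaust f (A : nat -> set T) : intg f ->
  (forall n, measurable (A n)) -> (forall x, f x != 0 -> \forall n \near \oo, A n x) ->
  \int[mu]_(x in A n) f x @[n --> \oo] --> \int[mu]_x f x.
Proof.
move=> fi mA eA.
under eq_cvg do rewrite Rintegral_mkcond.
apply: (@cvg_Rintegral_dominated _ _ (fun x => `|f x|) _ _ (integrable_normT fi) _).2.
- move=> n; apply/measurable_restrict => //.
  by apply: measurable_funTS; exact: integrable_measurable fi.
- move=> x; have [fx0|fx0] := eqVneq (f x) 0.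
    by apply: cvg_near_cst; apply: nearW => n; rewrite patchE fx0 if_same.
  apply: cvg_near_cst; apply: filterS (eA x fx0) => n Ax.
  by rewrite patchE mem_set.
- by move=> n x; rewrite patchE; case: ifP => // _; rewrite normr0.
Qed.

(** The counterpart for a nonnegative function whose integrability is still unknown: Fatou's lemma
    replaces domination. *)
Lemma integrable_exhaust f (A : nat -> set T) (C : R) :
  (forall x, 0 <= f x) ->
  (forall n, measurable (A n)) -> (forall x, f x != 0 -> \forall n \near \oo, A n x) ->
  (forall n, mu.-integrable (A n) (EFin \o f)) ->
  (\forall n \near \oo, \int[mu]_(x in A n) f x <= C) -> intg f.
Proof.
move=> f0 mA eA iA leC.
apply: (@integrable_le_fatou _ _ _ mu (fun n => f \_ (A n)) f C _ _ _ _).1.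
- by move=> n; rewrite -restrict_EFin; exact/(integrable_mkcond _ (mA n)).1.
- by move=> n x; rewrite patchE; case: ifP.
- move=> x; have [fx0|fx0] := eqVneq (f x) 0.
    by apply: cvg_near_cst; apply: nearW => n; rewrite patchE fx0 if_same.
  apply: cvg_near_cst; apply: filterS (eA x fx0) => n Ax.
  by rewrite patchE mem_set.
- by move: leC; apply: filterS => n; rewrite Rintegral_mkcond.
Qed.
End dominated.

(** * The fundamental theorem of calculus on segments and on the line *)

Section FTC.
Context {R : realType}.
Local Notation mu := (@lebesgue_measure R).
Implicit Types f F : R -> R.
Local Notation intg f := (mu.-integrable [set: R] (EFin \o f)).

Lemma FTC_segment f F (a b : R) : a < b ->
  (forall x, a <= x <= b -> {for x, continuous f}) ->
  (forall x, a <= x <= b -> is_derive x 1 F (f x)) ->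
  mu.-integrable `[a, b] (EFin \o f) /\ \int[mu]_(x in `[a, b]) f x = F b - F a.
Proof.
move=> ab cf dF.
have wc : {within `[a, b], continuous f}.
  by apply: continuous_in_subspaceT => x; rewrite inE/= in_itv/= => /cf.
split; first by apply: continuous_compact_integrable => //; exact: segment_compact.
have cF x : a <= x <= b -> {for x, continuous F}.
  by move=> /dF [dFx _]; exact/differentiable_continuous/derivable1_diffP.
rewrite /Rintegral (continuous_FTC2 ab wc (F := F))//.
- split.
  + by move=> x; rewrite in_itv/= => /andP[/ltW ax /ltW xb]; have [] : is_derive x 1 F (f x) by apply: dF; rewrite ax xb.
  + by apply: cvg_at_right_filter; apply: cF; rewrite lexx ltW.
  + by apply: cvg_at_left_filter; apply: cF; rewrite lexx ltW.
- move=> x; rewrite in_itv/= => /andP[/ltW ax /ltW xb].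
  by rewrite derive1E; have [_ ->] : is_derive x 1 F (f x) by apply: dF; rewrite ax xb.
Qed.

Lemma near_segment (x : R) : \forall n \near \oo, `[- n%:R, n%:R]%classic x.
Proof.
near=> n; rewrite /= in_itv/= -ler_norml.
by near: n; exact: nbhs_infty_ger.
Unshelve. all: by end_near. Qed.

(** Integrability being given, the integral is the limit over the segments [-n, n], so only the
    symmetric difference of the primitive has to converge. *)
Lemma FTC_line f F (l : R) : continuous f -> (forall x : R, is_derive x 1 F (f x)) ->
  intg f -> F n%:R - F (- n%:R) @[n --> \oo] --> l -> \int[mu]_x f x = l.
Proof.
move=> cf dF fi Fl.
have c1 : \int[mu]_(x in `[- n%:R, n%:R]) f x @[n --> \oo] --> \int[mu]_x f x.
  by apply: cvg_Rintegral_exhaust => // x _; exact: near_segment.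
apply: (cvg_unique _ c1) => //.
apply: cvg_trans Fl; apply: near_eq_cvg; near=> n.
apply/esym; apply: (@FTC_segment f F _ _ _ _ _).2 => //.
  by rewrite gtrN // ltr0n; near: n; exact: nbhs_infty_gt.
by move=> x _; exact: cf.
Unshelve. all: by end_near. Qed.

Lemma ge0_FTC_line f F (l : R) : (forall x, 0 <= f x) -> continuous f ->
  (forall x : R, is_derive x 1 F (f x)) ->
  F n%:R - F (- n%:R) @[n --> \oo] --> l -> intg f /\ \int[mu]_x f x = l.
Proof.
move=> f0 cf dF Fl.
(* The index is [n.+1] because [FTC_segment] requires a nondegenerate segment. *)
have sn n : mu.-integrable `[- n.+1%:R, n.+1%:R] (EFin \o f) /\
    \int[mu]_(x in `[- n.+1%:R, n.+1%:R]) f x = F n.+1%:R - F (- n.+1%:R).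
  by apply: FTC_segment => // [|x _]; [rewrite gtrN|exact: cf].
have fi : intg f.
  apply: (@integrable_exhaust _ _ _ mu f (fun n => `[- n.+1%:R, n.+1%:R]%classic) (l + 1)) => //.
  - move=> x _; have [N _ NP] := near_segment x; exists N => // n /= Nn.
    exact: (NP n.+1 (leqW Nn)).
  - by move=> n; exact: (sn n).1.
  - have : \forall n \near \oo, F n%:R - F (- n%:R) <= l + 1.
      by apply: (cvgr_le _ Fl); rewrite ltrDl.
    move=> [N _ NP]; exists N => // n /= Nn.
    by rewrite (sn n).2; exact: (NP n.+1 (leqW Nn)).
by split => //; exact: FTC_line Fl.
Qed.
End FTC.

(** * Differentiation rules for functions written pointwise *)

Section pointwise_derivatives.
Context {R : realType}.
Implicit Types (f g : R -> R) (x a b k : R).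

Lemma is_derive1_funD f g x a b : is_derive x 1 f a -> is_derive x 1 g b ->
  is_derive x 1 (fun y => f y + g y) (a + b).
Proof. exact: is_deriveD. Qed.

Lemma is_derive1_funB f g x a b : is_derive x 1 f a -> is_derive x 1 g b ->
  is_derive x 1 (fun y => f y - g y) (a - b).
Proof. exact: is_deriveB. Qed.

Lemma is_derive1_funM f g x a b : is_derive x 1 f a -> is_derive x 1 g b ->
  is_derive x 1 (fun y => f y * g y) (f x * b + g x * a).
Proof. exact: is_deriveM. Qed.

Lemma is_derive1_funV f x a : f x != 0 -> is_derive x 1 f a ->
  is_derive x 1 (fun y => (f y)^-1) (- a / f x ^+ 2).
Proof.
by move=> fx0 df; apply: is_derive_eq (is_deriveV fx0 df) _; rewrite mulrC mulrN -mulNr.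
Qed.

Lemma is_derive1_fun_comp f g x a b : is_derive (g x) 1 f a -> is_derive x 1 g b ->
  is_derive x 1 (fun y => f (g y)) (a * b).
Proof. exact: is_derive1_comp. Qed.

Lemma is_derive1_cst k x : is_derive x 1 (fun=> k) 0.
Proof. exact: is_derive_cst. Qed.

Lemma is_derive1_id x : is_derive x 1 (fun y : R => y) 1.
Proof. exact: is_derive_id. Qed.

Lemma is_derive1_subr k x : is_derive x 1 (fun y => y - k) 1.
Proof. by apply: is_derive_eq (is_derive1_funB (is_derive1_id x) (is_derive1_cst k x)) _; rewrite subr0. Qed.

Lemma is_derive1_subl k x : is_derive x 1 (fun y => k - y) (- 1).
Proof. by apply: is_derive_eq (is_derive1_funB (is_derive1_cst k x) (is_derive1_id x)) _; rewrite sub0r. Qed.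

Lemma is_derive1_fun_sqr f x a : is_derive x 1 f a -> is_derive x 1 (fun y => f y ^+ 2) (2 * f x * a).
Proof.
move=> df; apply: is_derive_eq (is_derive1_funM df df) _; ring.
Qed.
End pointwise_derivatives.

(** * Poisson kernels *)

Section kernels.
Context {R : realType}.
Local Notation mu := (@lebesgue_measure R).
Implicit Types (e d t x y z : R) (f F : R -> R).
Local Notation intg f := (mu.-integrable [set: R] (EFin \o f)).

Definition poisson e t : R := e / (t ^+ 2 + e ^+ 2).
Definition conj_poisson e t : R := t / (t ^+ 2 + e ^+ 2).

Lemma sqrD_gt0 e t : 0 < e -> 0 < t ^+ 2 + e ^+ 2.
Proof. by move=> e0; rewrite ltr_wpDl ?sqr_ge0// exprn_gt0. Qed.

Lemma poisson_ge0 e t : 0 < e -> 0 <= poisson e t.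
Proof. by move=> e0; rewrite divr_ge0 ?ltW// sqrD_gt0. Qed.

Lemma poissonN e t : poisson e (- t) = poisson e t.
Proof. by rewrite /poisson sqrrN. Qed.

Lemma conj_poissonN e t : conj_poisson e (- t) = - conj_poisson e t.
Proof. by rewrite /conj_poisson sqrrN mulNr. Qed.

Lemma poisson_sym e x y : poisson e (x - y) = poisson e (y - x).
Proof. by rewrite -poissonN opprB. Qed.

Lemma conj_poisson_sym e x y : conj_poisson e (x - y) = - conj_poisson e (y - x).
Proof. by rewrite -conj_poissonN opprB. Qed.

Lemma continuous_sqrD e x : continuous (fun y : R => (x - y) ^+ 2 + e ^+ 2).
Proof.
move=> y; apply: cvgD; last exact: cvg_cst.
by apply: cvg_sqr; apply: cvgB; [exact: cvg_cst|exact: cvg_id].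
Qed.

Lemma continuous_poisson e x : 0 < e -> continuous (fun y => poisson e (x - y)).
Proof.
move=> e0 y; apply: cvgM; first exact: cvg_cst.
by apply: cvgV; [rewrite gt_eqF// sqrD_gt0|exact: continuous_sqrD].
Qed.

Lemma continuous_conj_poisson e x : 0 < e -> continuous (fun y => conj_poisson e (x - y)).
Proof.
move=> e0 y; apply: cvgM; first by apply: cvgB; [exact: cvg_cst|exact: cvg_id].
by apply: cvgV; [rewrite gt_eqF// sqrD_gt0|exact: continuous_sqrD].
Qed.

Lemma poisson_integral e x : 0 < e ->
  intg (fun y => poisson e (x - y)) /\ \int[mu]_y poisson e (x - y) = pi.
Proof.
move=> e0.
apply: (@ge0_FTC_line _ _ (fun y => atan ((y - x) / e))).
- by move=> y; exact: poisson_ge0.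
- exact: continuous_poisson.
- move=> y.
  have h : is_derive y 1 (fun y : R => (y - x) / e) (1 / e).
    apply: is_derive_eq (is_derive1_funM (is_derive1_subr x y) (is_derive1_cst e^-1 y)) _.
    by rewrite mulr0 add0r mulr1 div1r.
  apply: is_derive_eq (is_derive1_fun_comp (is_derive1_atan _) h) _.
  have := sqrD_gt0 (x - y) e0; rewrite /poisson => h1.
  by field; rewrite !gt_eqF.
- have cn : (n%:R - x) / e @[n --> \oo] --> +oo.
    apply/cvgryPge => A; near=> n; rewrite ler_pdivlMr// lerBrDr.
    by near: n; exact: nbhs_infty_ger.
  have cn' : (n%:R + x) / e @[n --> \oo] --> +oo.
    apply/cvgryPge => A; near=> n; rewrite ler_pdivlMr// -lerBlDr.
    by near: n; exact: nbhs_infty_ger.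
  have c1 : atan ((n%:R - x) / e) @[n --> \oo] --> (pi / 2 : R).
    exact: (@cvg_comp _ _ _ (fun n : nat => (n%:R - x) / e) atan _ _ _ cn (@cvgy_atan R)).
  have c2 : atan ((- n%:R - x) / e) @[n --> \oo] --> (- (pi / 2) : R).
    under eq_cvg do rewrite -opprD mulNr atanN.
    by apply: cvgN; exact: (@cvg_comp _ _ _ (fun n : nat => (n%:R + x) / e) atan _ _ _ cn' (@cvgy_atan R)).
  rewrite (_ : pi = pi / 2 - - (pi / 2)); last by field.
  exact: cvgB.
Unshelve. all: by end_near. Qed.

(** From p_e^2 + q_e^2 = p_e / e, an identity which also bounds the norm of q_e in the next
    lemma. *)
Lemma L2_poisson e x : 0 < e -> L2 mu (fun y => poisson e (x - y)).
Proof.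
move=> e0; split; first exact: continuous_measurable_fun (continuous_poisson e0).
apply: le_integrableT (integrableZT e^-1 (poisson_integral x e0).1).
  by apply: measurable_funX; exact: continuous_measurable_fun (continuous_poisson e0).
move=> y; rewrite ger0_norm ?sqr_ge0// /poisson.
have h1 := sqrD_gt0 (x - y) e0.
rewrite -subr_ge0 (_ : _ - _ = ((x - y) / ((x - y) ^+ 2 + e ^+ 2)) ^+ 2) ?sqr_ge0//.
by field; rewrite !gt_eqF.
Qed.

Lemma L2_conj_poisson e x : 0 < e -> L2 mu (fun y => conj_poisson e (x - y)) /\
  \int[mu]_y (conj_poisson e (x - y) ^+ 2) <= pi / e.
Proof.
move=> e0.
have mq : measurable_fun [set: R] (fun y => conj_poisson e (x - y)).
  exact: continuous_measurable_fun (continuous_conj_poisson e0).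
have le y : `|conj_poisson e (x - y) ^+ 2| <= e^-1 * poisson e (x - y).
  rewrite ger0_norm ?sqr_ge0// /poisson /conj_poisson.
  have h1 := sqrD_gt0 (x - y) e0.
  rewrite -subr_ge0 (_ : _ - _ = (e / ((x - y) ^+ 2 + e ^+ 2)) ^+ 2) ?sqr_ge0//.
  by field; rewrite !gt_eqF.
have ip := integrableZT e^-1 (poisson_integral x e0).1.
have iq : intg (fun y => conj_poisson e (x - y) ^+ 2).
  by apply: le_integrableT ip => //; exact: measurable_funX.
split; first by split.
apply: le_trans (le_RintegralT iq ip _) _; last first.
  by rewrite RintegralZT ?(poisson_integral x e0).2 1?mulrC//; exact: (poisson_integral x e0).1.
by move=> y; apply: le_trans (le y); exact: ler_norm.
Qed.

(** Dividing both arguments by n^2 changes the difference of logarithms by nothing and leaves a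
    function of 1 / n that is continuous at 0, where both arguments equal s^2. The two ends of the
    line are s = 1 and s = -1. *)
Lemma cvg_ln_ratio e d x z (s : R) : 0 < e -> 0 < d -> s != 0 ->
  ln ((s * n%:R - z) ^+ 2 + d ^+ 2) - ln ((x - s * n%:R) ^+ 2 + e ^+ 2) @[n --> \oo] --> (0 : R).
Proof.
move=> e0 d0 s0.
pose G (v : R) := ln ((s - v * z) ^+ 2 + (v * d) ^+ 2) - ln ((v * x - s) ^+ 2 + (v * e) ^+ 2).
have sq0 a b : 0 < s ^+ 2 -> 0 < (s - 0 * a) ^+ 2 + (0 * b) ^+ 2 :> R.
  by move=> ss; rewrite !mul0r subr0 expr0n/= addr0.
have ss : 0 < s ^+ 2 by rewrite exprn_even_gt0.
have cG : G v @[v --> (0 : R)] --> (0 : R).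
  rewrite -[X in _ --> X](subrr (ln (s ^+ 2))).
  have cvl (f : R -> R) : f v @[v --> (0 : R)] --> s ^+ 2 -> ln (f v) @[v --> (0 : R)] --> ln (s ^+ 2).
    by move=> cf; apply: continuous_cvg cf; exact: continuous_ln.
  have cz (a : R) : v * a @[v --> (0 : R)] --> (0 : R).
    by rewrite -[X in _ --> X](mul0r a); apply: cvgM; [exact: cvg_id|exact: cvg_cst].
  rewrite /G; apply: cvgB.
    apply: (cvl (fun v => (s - v * z) ^+ 2 + (v * d) ^+ 2)).
    rewrite -[X in _ --> X]addr0 -[X in _ + X](expr0n _ 2) -[X in X ^+ 2 + _]subr0.
    by apply: cvgD; apply: cvg_sqr => //; apply: cvgB => //; exact: cvg_cst.
  apply: (cvl (fun v => (v * x - s) ^+ 2 + (v * e) ^+ 2)).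
  rewrite -[X in _ --> X]addr0 -[X in _ + X](expr0n _ 2) -[X in X + _]sqrrN -[X in X ^+ 2 + _]sub0r.
  by apply: cvgD; apply: cvg_sqr => //; apply: cvgB => //; exact: cvg_cst.
have cn : (n%:R : R)^-1 @[n --> \oo] --> (0 : R).
  apply: (gtr0_cvgV0 _).2 cvgr_idn; near=> n; rewrite ltr0n; near: n; exact: nbhs_infty_gt.
have c2 : G (n%:R)^-1 @[n --> \oo] --> (0 : R) by exact: (@cvg_comp _ _ _ (fun n : nat => (n%:R)^-1) G _ _ _ cn cG).
apply: cvg_trans c2; apply: near_eq_cvg; near=> n.
have n0 : 0 < n%:R :> R by rewrite ltr0n; near: n; exact: nbhs_infty_gt.
have h a b (f : R) : 0 < f -> ln ((a - n%:R^-1 * b) ^+ 2 + (n%:R^-1 * f) ^+ 2) = ln ((n%:R * a - b) ^+ 2 + f ^+ 2) - ln (n%:R ^+ 2).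
  move=> f0; rewrite -ln_div ?posrE ?sqrD_gt0 ?exprn_gt0//; congr ln.
  by field; rewrite gt_eqF.
rewrite /G h// (_ : _ * x - s = - (s - n%:R^-1 * x)) ?sqrrN ?h//; last by ring.
rewrite (_ : x - s * n%:R = - (n%:R * s - x)) ?sqrrN; last by ring.
by rewrite (mulrC s); ring.
Unshelve. all: by end_near.
Qed.

(** Neither summand is integrable alone, but their tails -1/y and 1/y cancel. The primitive is half
    the logarithm of a ratio which tends to 1 at both ends. *)
Lemma conj_poisson_sum_integral e d x z : 0 < e -> 0 < d ->
  intg (fun y => conj_poisson e (x - y) + conj_poisson d (y - z)) ->
  \int[mu]_y (conj_poisson e (x - y) + conj_poisson d (y - z)) = 0.
Proof.
move=> e0 d0 iq.
pose F y := 2^-1 * (ln ((y - z) ^+ 2 + d ^+ 2) - ln ((x - y) ^+ 2 + e ^+ 2)).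
apply: (@FTC_line _ _ F) => //.
- move=> y; apply: cvgD; first exact: continuous_conj_poisson.
  under eq_cvg do rewrite conj_poisson_sym.
  by rewrite conj_poisson_sym; apply: cvgN; exact: continuous_conj_poisson.
- move=> y.
  have h1 := sqrD_gt0 (y - z) d0.
  have h2 := sqrD_gt0 (x - y) e0.
  have d1 : is_derive y 1 (fun y : R => (y - z) ^+ 2 + d ^+ 2) (2 * (y - z)).
    apply: is_derive_eq (is_derive1_funD (is_derive1_fun_sqr (is_derive1_subr z y)) (is_derive1_cst _ y)) _.
    by rewrite addr0 mulr1.
  have d2 : is_derive y 1 (fun y : R => (x - y) ^+ 2 + e ^+ 2) (- (2 * (x - y))).
    apply: is_derive_eq (is_derive1_funD (is_derive1_fun_sqr (is_derive1_subl x y)) (is_derive1_cst _ y)) _.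
    by rewrite addr0 mulrN1.
  have d3 := @is_derive1_fun_comp R (@ln R) (fun y => (y - z) ^+ 2 + d ^+ 2) y _ _ (is_derive1_ln h1) d1.
  have d4 := @is_derive1_fun_comp R (@ln R) (fun y => (x - y) ^+ 2 + e ^+ 2) y _ _ (is_derive1_ln h2) d2.
  have d5 := is_derive1_funM (is_derive1_cst (2^-1 : R) y) (is_derive1_funB d3 d4).
  rewrite /F; apply: is_derive_eq d5 _.
  by rewrite /conj_poisson; field; rewrite !gt_eqF.
- rewrite -(subrr (2^-1 * 0)); apply: cvgB; apply: cvgM; try exact: cvg_cst.
    by have := cvg_ln_ratio x z e0 d0 (oner_neq0 R); under eq_cvg do rewrite mul1r.
  by have := cvg_ln_ratio x z e0 d0 (_ : -1 != 0); under eq_cvg do rewrite mulN1r; apply; rewrite oppr_eq0 oner_eq0.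
Qed.

(** This is the convolution of Cauchy kernels without complex numbers: partial fractions reduce both
    products to [q] and to the sum and difference of two Poisson kernels, whose integrals are 0, 2
    pi and 0. The condition [x != z] keeps w^2 + (e - d)^2 nonzero when e = d; the uses of the lemma
    leave out that null set. *)
Lemma poisson_conj_poisson e d x z : 0 < e -> 0 < d -> x != z ->
  \int[mu]_y (poisson e (x - y) * conj_poisson d (y - z)) =
  pi * conj_poisson (e + d) (x - z) /\
  \int[mu]_y (conj_poisson e (x - y) * conj_poisson d (y - z)) =
  - (pi * poisson (e + d) (x - z)).
Proof.
move=> e0 d0 xz.
set w := x - z; have w0 : w != 0 by rewrite subr_eq0.
have [ip1 p1E] := poisson_integral x e0.
have [ip2 p2E] : intg (fun y => poisson d (y - z)) /\ \int[mu]_y poisson d (y - z) = pi.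
  have [h1 h2] := poisson_integral z d0.
  by rewrite (_ : (fun y => poisson d (y - z)) = (fun y => poisson d (z - y)))//; apply/funext => y; exact: poisson_sym.
have Lq2 : L2 mu (fun y => conj_poisson d (y - z)).
  have := L2Z (-1) (L2_conj_poisson z d0).1; congr (L2 mu _); apply/funext => y.
  by rewrite mulN1r -conj_poisson_sym.
have iqq := L2_integrableM (L2_conj_poisson x e0).1 Lq2.
have ipq := L2_integrableM (L2_poisson x e0) Lq2.
have s0 : 0 < e + d by exact: addr_gt0.
(* The kernels with parameter [e - d] at [w], where the parameter may be negative or zero. *)
pose qd := w / (w ^+ 2 + (e - d) ^+ 2); pose pd := (e - d) / (w ^+ 2 + (e - d) ^+ 2).
have D1 : 0 < w ^+ 2 + (e + d) ^+ 2 by exact: sqrD_gt0.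
have D2 : 0 < w ^+ 2 + (e - d) ^+ 2 by rewrite ltr_pwDl ?sqr_ge0// exprn_even_gt0.
pose q y := conj_poisson e (x - y) + conj_poisson d (y - z).
(* real and imaginary parts of the partial fraction expansion of
   [1 / ((x - y + i e) (y - z +- i d))] *)
have qqE y : 2 * (conj_poisson e (x - y) * conj_poisson d (y - z)) =
    (conj_poisson (e + d) w + qd) * q y
    + - poisson (e + d) w * (poisson e (x - y) + poisson d (y - z))
    + - pd * (poisson e (x - y) - poisson d (y - z)).
  have h1 := sqrD_gt0 (x - y) e0; have h2 := sqrD_gt0 (y - z) d0.
  move: D1 D2; rewrite /q /qd /pd /conj_poisson /poisson /w => D1 D2.
  by field; rewrite !gt_eqF.
have pqE y : 2 * (poisson e (x - y) * conj_poisson d (y - z)) =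
    (poisson (e + d) w + pd) * q y
    + conj_poisson (e + d) w * (poisson e (x - y) + poisson d (y - z))
    + qd * (poisson e (x - y) - poisson d (y - z)).
  have h1 := sqrD_gt0 (x - y) e0; have h2 := sqrD_gt0 (y - z) d0.
  move: D1 D2; rewrite /q /qd /pd /conj_poisson /poisson /w => D1 D2.
  by field; rewrite !gt_eqF.
have ipD := integrableDT ip1 ip2; have ipB := integrableBT ip1 ip2.
have c0 : conj_poisson (e + d) w + qd != 0.
  rewrite /conj_poisson /qd -mulrDr mulf_neq0// gt_eqF//.
  by rewrite addr_gt0// invr_gt0.
(* Read off from [qqE]: the product on the left is integrable as a product of two L^2 functions, and
   the coefficient of [q] is a positive multiple of [w], hence nonzero. *)
have iq : intg q.
  have := integrableZT (conj_poisson (e + d) w + qd)^-1 (integrableDT (integrableDT (integrableZT 2 iqq)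
    (integrableZT (poisson (e + d) w) ipD)) (integrableZT pd ipB)).
  congr (mu.-integrable _ _); apply/funext => y /=; congr EFin.
  by rewrite qqE; field.
have q0 : \int[mu]_y q y = 0 by exact: conj_poisson_sum_integral.
have c2 : (2 : R) != 0 by [].
have lin A B C : \int[mu]_y (A * q y + B * (poisson e (x - y) + poisson d (y - z))
    + C * (poisson e (x - y) - poisson d (y - z))) = B * (pi + pi).
  rewrite RintegralDT; [|by apply: integrableDT; exact: integrableZT|exact: integrableZT].
  rewrite RintegralDT; [|exact: integrableZT..].
  rewrite !RintegralZT// RintegralDT// RintegralBT// q0 p1E p2E; ring.
split; apply: (mulfI c2); rewrite -RintegralZT//.
  by under eq_Rintegral do rewrite pqE; rewrite lin; ring.
under eq_Rintegral do rewrite qqE.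
rewrite lin; ring.
Qed.
End kernels.

(** * Poisson integrals and the exchange of integrations *)

Section operators.
Context {R : realType}.
Local Notation mu := (@lebesgue_measure R).
Implicit Types (e d t x y z : R) (f g h a b : R -> R).
Local Notation intg f := (mu.-integrable [set: R] (EFin \o f)).

Definition poisson_op e f x : R := \int[mu]_y (poisson e (x - y) * f y).
Definition conj_poisson_op e f x : R := \int[mu]_y (conj_poisson e (x - y) * f y).

Lemma measurable_diff_comp f : measurable_fun [set: R] f ->
  measurable_fun [set: R * R] (fun xy => f (xy.1 - xy.2)).
Proof.
move=> mf; apply: (measurableT_comp mf).
by apply: measurable_funB; [exact: measurable_fst|exact: measurable_snd].
Qed.

Lemma measurable_poisson e : 0 < e -> measurable_fun [set: R] (poisson e).
Proof.
move=> e0; have := @continuous_measurable_fun _ _ (continuous_poisson (x := 0) e0).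
by congr (measurable_fun _ _); apply/funext => y; rewrite sub0r poissonN.
Qed.

Lemma measurable_conj_poisson e : 0 < e -> measurable_fun [set: R] (conj_poisson e).
Proof.
move=> e0; have m := @continuous_measurable_fun _ _ (continuous_conj_poisson (x := 0) e0).
have := measurable_funM (measurable_cst (-1 : R)) m.
by congr (measurable_fun _ _); apply/funext => y /=; rewrite sub0r conj_poissonN mulN1r opprK.
Qed.

Lemma poisson_bound e t : 0 < e -> `|poisson e t| <= e^-1.
Proof.
move=> e0; rewrite ger0_norm ?poisson_ge0// /poisson.
have := sqrD_gt0 t e0 => h.
by rewrite ler_pdivrMr// mulrC ler_pdivlMr// -expr2 lerDr sqr_ge0.
Qed.

Lemma conj_poisson_bound e t : 0 < e -> `|conj_poisson e t| <= e^-1.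
Proof.
move=> e0; rewrite /conj_poisson normrM normfV.
have h := sqrD_gt0 t e0; rewrite [X in _ / X]gtr0_norm//.
rewrite ler_pdivrMr// mulrC ler_pdivlMr// -(real_normK (num_real t)).
have := normr_ge0 t; set s := `|t| => s0; have := sqr_ge0 (s - e); nra.
Qed.

(** A Schur-type test: a bound [m] on the integrals in the first variable yields at once the
    integrability of the integrals in the second variable and a bound on their total. *)
Lemma Tonelli_le (G : R * R -> R) (m : R -> R) : measurable_fun [set: R * R] G ->
  (forall xy, 0 <= G xy) ->
  (forall x, intg (fun y => G (x, y))) ->
  (forall y, intg (fun x => G (x, y))) -> (forall y, \int[mu]_x G (x, y) <= m y) ->
  intg m -> intg (fun x => \int[mu]_y G (x, y)) /\
  \int[mu]_x (\int[mu]_y G (x, y)) <= \int[mu]_y m y.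
Proof.
move=> mG G0 i1 i2 Gm im.
have e1 x : (\int[mu]_y (G (x, y))%:E)%E = (\int[mu]_y G (x, y))%:E.
  by rewrite fineK//; exact: integrable_fin_num (i1 x).
have e2 y : (\int[mu]_x (G (x, y))%:E)%E = (\int[mu]_x G (x, y))%:E.
  by rewrite fineK//; exact: integrable_fin_num (i2 y).
have mEG : measurable_fun [set: R * R] (EFin \o G) by exact/measurable_EFinP.
have m1 := @measurable_fun_fubini_tonelli_F _ _ _ _ R mu (EFin \o G) mEG (fun xy => G0 xy).
have m2 := @measurable_fun_fubini_tonelli_G _ _ _ _ R mu (EFin \o G) mEG (fun xy => G0 xy).
have := @fubini_tonelli _ _ _ _ R mu mu (EFin \o G) mEG (fun xy => G0 xy).
rewrite /fubini_F/= in m1; rewrite /fubini_G/= in m2.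
rewrite /=; under eq_integral do rewrite e1; under [RHS]eq_integral do rewrite e2.
move=> tonelli.
have le : (\int[mu]_x (\int[mu]_y G (x, y))%:E <= \int[mu]_y (m y)%:E)%E.
  rewrite tonelli; apply: ge0_le_integral => //.
  - by move=> y _; rewrite lee_fin; apply: Rintegral_ge0.
  - by under eq_fun do rewrite -e2.
  - exact: measurable_int im.
  - by move=> y _; rewrite lee_fin.
have i : intg (fun x => \int[mu]_y G (x, y)).
  apply/integrableP; split; first by rewrite /comp; under eq_fun do rewrite -e1.
  under eq_integral do rewrite /= ger0_norm ?Rintegral_ge0//.
  by apply: le_lt_trans le _; rewrite ltey_eq integrable_fin_num.
split => //; rewrite -lee_fin !fineK//; exact: integrable_fin_num.
Qed.

(** Since the kernel is not integrable, absolute convergence rests on the integrability of [a]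
    together with a bound on the inner integral that is uniform in [y]. *)
Lemma Fubini_conj_poisson d a b : 0 < d -> intg a -> L2 mu b ->
  intg (fun y => a y * conj_poisson_op d b y) /\
  \int[mu]_y (a y * conj_poisson_op d b y) =
  \int[mu]_z (b z * \int[mu]_y (a y * conj_poisson d (y - z))).
Proof.
move=> d0 ia Lb.
pose f (yz : R * R) := a yz.1 * (conj_poisson d (yz.1 - yz.2) * b yz.2).
have mf : measurable_fun [set: R * R] (EFin \o f).
  apply/measurable_EFinP; apply: measurable_funM.
    exact: measurableT_comp (integrable_measurable ia) measurable_fst.
  apply: measurable_funM; first exact: measurable_diff_comp (measurable_conj_poisson d0).
  exact: measurableT_comp Lb.1 measurable_snd.
have iqb y : intg (fun z => conj_poisson d (y - z) * b z).
  exact: L2_integrableM (L2_conj_poisson y d0).1 Lb.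
have iaq z : intg (fun y => a y * conj_poisson d (y - z)).
  apply: (@integrable_mul_bounded _ _ _ _ _ _ d^-1) => //.
    apply: measurableT_comp (measurable_conj_poisson d0) _.
    by apply: measurable_funB => //; exact: measurable_cst.
  by move=> y; exact: conj_poisson_bound.
have FE y : (\int[mu]_z (f (y, z))%:E)%E = (a y * conj_poisson_op d b y)%:E.
  rewrite /conj_poisson_op -RintegralZT// fineK//.
  exact: integrable_fin_num (integrableZT (a y) (iqb y)).
have GE z : (\int[mu]_y (f (y, z))%:E)%E = (b z * \int[mu]_y (a y * conj_poisson d (y - z)))%:E.
  rewrite -RintegralZT// fineK; last exact: integrable_fin_num (integrableZT (b z) (iaq z)).
  by apply: eq_integral => y _; rewrite /f/=; congr EFin; ring.
have absE y : (\int[mu]_z `|(f (y, z))%:E|)%E =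
    (`|a y| * \int[mu]_z `|conj_poisson d (y - z) * b z|)%:E.
  rewrite -RintegralZT; last exact: integrable_normT.
  rewrite fineK; last exact: integrable_fin_num (integrableZT `|a y| (integrable_normT (iqb y))).
  by apply: eq_integral => z _; rewrite /f/= normrM.
(* From |q b| <= q^2 + b^2 and the bound pi / d on the integral of q^2. *)
pose C := pi / d + \int[mu]_z (b z ^+ 2).
have le_C y : \int[mu]_z `|conj_poisson d (y - z) * b z| <= C.
  have [Lq qC] := L2_conj_poisson y d0.
  apply: le_trans (lerD qC (lexx _)).
  rewrite -RintegralDT; [|exact: Lq.2|exact: Lb.2].
  apply: le_RintegralT; [exact: integrable_normT|exact: integrableDT Lq.2 Lb.2|].
  by move=> z; rewrite ler_norml; apply/andP; split; nra.
have fin : (mu \x mu)%E.-integrable setT (EFin \o f).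
  apply: (integrable12ltyP mu mu mf).2.
  have mabs : measurable_fun [set: R * R] (abse \o (EFin \o f)) by exact: measurableT_comp.
  have mF := @measurable_fun_fubini_tonelli_F _ _ _ _ R mu (abse \o (EFin \o f)) mabs (fun xy => abse_ge0 _).
  apply: (@le_lt_trans _ _ (\int[mu]_y (C * `|a y|)%:E)%E); last first.
    by rewrite ltey_eq integrable_fin_num//; exact: integrableZT (integrable_normT ia).
  apply: ge0_le_integral => //.
  - by move=> y _; exact: integral_ge0.
  - exact: measurable_int (integrableZT C (integrable_normT ia)).
  - by move=> y _; rewrite [leLHS]absE lee_fin mulrC ler_wpM2r.
have := integrable_fubini_F fin; rewrite /fubini_F => iF.
split.
  by move: iF; congr (mu.-integrable _ _); apply/funext => y; rewrite /= -FE.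
have := Fubini fin; rewrite /=.
under eq_integral do rewrite FE; under [RHS]eq_integral do rewrite GE.
by move=> e; rewrite /Rintegral e.
Qed.

(** Fubini's theorem provides measurability only after multiplication by an integrable function; the
    kernel p_1 is taken for it and then divided out, being positive. *)
Lemma measurable_conj_poisson_op d b : 0 < d -> L2 mu b ->
  measurable_fun [set: R] (conj_poisson_op d b).
Proof.
move=> d0 Lb.
have [ip _] := poisson_integral (0 : R) (ltr01 : 0 < 1 :> R).
have [/integrable_measurable mab _] := Fubini_conj_poisson d0 ip Lb.
have mV : measurable_fun [set: R] (fun y => (0 - y) ^+ 2 + 1 ^+ 2 : R).
  by apply: continuous_measurable_fun; exact: (@continuous_sqrD _ 1 0).
have := measurable_funM mV mab; congr (measurable_fun _ _); apply/funext => y /=.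
by rewrite mulrA /poisson mulrCA mulfV ?gt_eqF ?sqrD_gt0// mulr1 mul1r.
Qed.
End operators.

(** * The conjugate Poisson operators on square-integrable functions *)

Section conj_poisson_L2.
Context {R : realType}.
Local Notation mu := (@lebesgue_measure R).
Implicit Types (e d t x y z : R) (f g h a b : R -> R).
Local Notation intg f := (mu.-integrable [set: R] (EFin \o f)).
Local Notation Q := conj_poisson_op.
Local Notation sqn f := (\int[mu]_x (f x ^+ 2)).

Lemma sqn_ge0 f : 0 <= sqn f.
Proof. by apply: Rintegral_ge0 => x _; exact: sqr_ge0. Qed.

Lemma ae_neq x : {ae mu, forall y, x != y}.
Proof.
exists [set x]; split; [exact: measurable_set1|exact: lebesgue_measure_set1|].
by move=> y /= /negP/negPn/eqP ->.
Qed.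

Lemma conj_poisson_op_antisym d f h : 0 < d -> intg f -> L2 mu h ->
  \int[mu]_x (f x * Q d h x) = - \int[mu]_x (h x * Q d f x).
Proof.
move=> d0 fi Lh; rewrite (Fubini_conj_poisson d0 fi Lh).2 -RintegralNT.
apply: eq_Rintegral => z _; rewrite -mulrN; congr (_ * _).
rewrite /conj_poisson_op -RintegralNT; apply: eq_Rintegral => y _.
by rewrite conj_poisson_sym; ring.
Qed.

(** Here the Poisson kernel is the integrable factor in Fubini's theorem, so [f] is any L^2
    function. *)
Lemma poisson_conj_poisson_op e d f x : 0 < e -> 0 < d -> L2 mu f ->
  poisson_op e (Q d f) x = pi * Q (e + d) f x.
Proof.
move=> e0 d0 Lf; rewrite /poisson_op.
rewrite (Fubini_conj_poisson d0 (poisson_integral x e0).1 Lf).2.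
rewrite -RintegralZT; last exact: L2_integrableM (L2_conj_poisson x (addr_gt0 e0 d0)).1 Lf.
apply: ae_eq_Rintegral; apply: aeS (ae_neq x) => z xz.
by rewrite (poisson_conj_poisson e0 d0 xz).1; ring.
Qed.

(** Both kernels fail to be integrable, so [f] has to be the integrable factor: antisymmetry moves
    the inner operator from [f] onto the outer kernel. *)
Lemma conj_poisson_op_comp e d f x : 0 < e -> 0 < d -> intg f -> L2 mu f ->
  Q e (Q d f) x = - (pi * poisson_op (e + d) f x).
Proof.
move=> e0 d0 fi Lf; apply: oppr_inj; rewrite opprK.
have Lh := (L2_conj_poisson x e0).1.
rewrite [X in - X](_ : _ = \int[mu]_y (conj_poisson e (x - y) * Q d f y))//.
rewrite -(conj_poisson_op_antisym d0 fi Lh) /poisson_op.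
rewrite -RintegralZT; last exact: L2_integrableM (L2_poisson x (addr_gt0 e0 d0)) Lf.
apply: ae_eq_Rintegral; apply: aeS (ae_neq x) => z xz.
rewrite mulrA -(opprK (pi * _)) -(poisson_conj_poisson e0 d0 xz).2 mulrC; congr (_ * _).
rewrite /conj_poisson_op -RintegralNT; apply: eq_Rintegral => y _.
by rewrite conj_poisson_sym; ring.
Qed.

(** Young's inequality for an integrable function and an L^2 kernel. The bound obtained depends on
    [d] and serves only for membership in L^2. *)
Lemma L2_conj_poisson_op1 d f : 0 < d -> intg f -> L2 mu f -> L2 mu (Q d f).
Proof.
move=> d0 fi Lf; have mQ := measurable_conj_poisson_op d0 Lf.
split => //.
pose G (xy : R * R) := `|f xy.2| * conj_poisson d (xy.1 - xy.2) ^+ 2.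
have mf : measurable_fun [set: R] (fun y => `|f y|).
  exact: integrable_measurable (integrable_normT fi).
have mG : measurable_fun [set: R * R] G.
  apply: measurable_funM; first exact: measurableT_comp mf measurable_snd.
  by apply: measurable_funX; exact: measurable_diff_comp (measurable_conj_poisson d0).
have i1 x : intg (fun y => G (x, y)).
  apply: (@integrable_mul_bounded _ _ _ _ _ _ (d^-1 ^+ 2)); first exact: integrable_normT.
    apply: measurable_funX; exact: (L2_conj_poisson x d0).1.1.
  by move=> y; rewrite normrX lerXn2r ?nnegrE ?conj_poisson_bound// invr_ge0 ltW.
have qE y : (fun x => conj_poisson d (x - y) ^+ 2) = (fun x => conj_poisson d (y - x) ^+ 2).
  by apply/funext => x; rewrite conj_poisson_sym sqrrN.
have i2 y : intg (fun x => G (x, y)).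
  by rewrite /G/=; apply: integrableZT; rewrite qE; exact: (L2_conj_poisson y d0).1.2.
have i2m y : \int[mu]_x G (x, y) <= pi / d * `|f y|.
  rewrite /G/= RintegralZT; last by rewrite qE; exact: (L2_conj_poisson y d0).1.2.
  by rewrite mulrC ler_wpM2r// qE; exact: (L2_conj_poisson y d0).2.
have [iG _] := Tonelli_le mG (fun xy => mulr_ge0 (normr_ge0 _) (sqr_ge0 _)) i1 i2 i2m
  (integrableZT _ (integrable_normT fi)).
apply: le_integrableT (integrableZT (\int[mu]_y `|f y|) iG); first exact: measurable_funX.
move=> x; rewrite ger0_norm ?sqr_ge0//.
(* Cauchy-Schwarz with weight |f| is applied to the sign of [f] and the kernel. *)
have sg y : `|f y| * Num.sg (f y) = f y by rewrite mulrC -numEsg.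
have h1 : (fun y => `|f y| * Num.sg (f y) ^+ 2) = (fun y => `|f y|).
  by apply/funext => y; rewrite expr2 mulrA sg mulrC -normrEsg.
have h2 : (fun y => `|f y| * (Num.sg (f y) * conj_poisson d (x - y))) = (fun y => conj_poisson d (x - y) * f y).
  by apply/funext => y; rewrite mulrA sg mulrC.
have := @weighted_Cauchy_Schwarz _ _ _ mu (fun y => `|f y|) (fun y => Num.sg (f y)) (fun y => conj_poisson d (x - y)).
rewrite h1 h2; apply => //; first exact: integrable_normT.
- exact: i1.
- exact: L2_integrableM (L2_conj_poisson x d0).1 Lf.
Qed.

(** Jensen's inequality for the probability density p_d / pi, then Tonelli's theorem. The average
    [g] is given by an equation so that it can be a conjugate Poisson integral, already known to be
    measurable. *)
Lemma poisson_contraction d h g : 0 < d -> L2 mu h -> measurable_fun [set: R] g ->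
  (forall x, pi * g x = poisson_op d h x) -> L2 mu g /\ sqn g <= sqn h.
Proof.
move=> d0 Lh mg gE.
have pi0 := pi_gt0 R.
pose G (xy : R * R) := pi^-1 * (h xy.2 ^+ 2 * poisson d (xy.1 - xy.2)).
have mG : measurable_fun [set: R * R] G.
  apply: measurable_funM => //; apply: measurable_funM.
    exact: measurableT_comp (measurable_funX 2 Lh.1) measurable_snd.
  exact: measurable_diff_comp (measurable_poisson d0).
have i1' x : intg (fun y => h y ^+ 2 * poisson d (x - y)).
  apply: (@integrable_mul_bounded _ _ _ _ _ _ d^-1); first exact: Lh.2.
    exact: (L2_poisson x d0).1.
  by move=> y; exact: poisson_bound.
have i1 x : intg (fun y => G (x, y)) by rewrite /G/=; exact: integrableZT.
have pE y : (fun x => poisson d (x - y)) = (fun x => poisson d (y - x)).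
  by apply/funext => x; exact: poisson_sym.
have i2' y : intg (fun x => poisson d (x - y)) by rewrite pE; exact: (poisson_integral y d0).1.
have i2 y : intg (fun x => G (x, y)) by rewrite /G/=; do 2 apply: integrableZT.
have i2m y : \int[mu]_x G (x, y) <= h y ^+ 2.
  rewrite /G/= RintegralZT; last exact: integrableZT.
  rewrite RintegralZT// pE (poisson_integral y d0).2 mulrCA mulVf ?mulr1//.
  by rewrite gt_eqF.
have G0 xy : 0 <= G xy by apply: mulr_ge0; [rewrite invr_ge0; exact: ltW|apply: mulr_ge0; [exact: sqr_ge0|exact: poisson_ge0]].
have [iG leG] := Tonelli_le mG G0 i1 i2 i2m Lh.2.
have gG x : g x ^+ 2 <= \int[mu]_y G (x, y).
  rewrite /G/= RintegralZT// -(@ler_pM2l _ (pi ^+ 2)) ?exprn_gt0// -exprMn gE.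
  rewrite expr2 -mulrA [X in _ <= _ * X]mulrA mulfV ?gt_eqF// mul1r.
  have := @weighted_Cauchy_Schwarz _ _ _ mu (fun y => poisson d (x - y)) (fun=> 1) h.
  have -> : (fun y => poisson d (x - y) * 1 ^+ 2) = (fun y => poisson d (x - y)).
    by apply/funext => y; rewrite expr1n mulr1.
  have -> : (fun y => poisson d (x - y) * h y ^+ 2) = (fun y => h y ^+ 2 * poisson d (x - y)).
    by apply/funext => y; rewrite mulrC.
  have -> : (fun y => poisson d (x - y) * (1 * h y)) = (fun y => poisson d (x - y) * h y).
    by apply/funext => y; rewrite mul1r.
  rewrite (poisson_integral x d0).2; apply => //.
  - by move=> y; exact: poisson_ge0.
  - exact: (poisson_integral x d0).1.
  - exact: L2_integrableM (L2_poisson x d0) Lh.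
have Lg : L2 mu g.
  split => //; apply: le_integrableT iG; first exact: measurable_funX.
  by move=> x; rewrite ger0_norm ?sqr_ge0.
by split => //; apply: le_trans leG; apply: le_RintegralT; [exact: Lg.2|exact: iG|].
Qed.

Lemma conj_poisson_op_nonincreasing e d f : 0 < e -> 0 < d -> intg f -> L2 mu f ->
  sqn (Q (e + d) f) <= sqn (Q d f).
Proof.
move=> e0 d0 fi Lf.
apply: (poisson_contraction e0 (L2_conj_poisson_op1 d0 fi Lf) _ _).2.
  exact: measurable_conj_poisson_op (addr_gt0 e0 d0) Lf.
by move=> x; rewrite poisson_conj_poisson_op.
Qed.

(** Antisymmetry followed by the composition formula. That only [e + d] occurs on the right is what
    produces the second difference. *)
Lemma conj_poisson_op_inner e d f : 0 < e -> 0 < d -> intg f -> L2 mu f ->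
  \int[mu]_x (Q e f x * Q d f x) = pi * \int[mu]_x (f x * poisson_op (e + d) f x).
Proof.
move=> e0 d0 fi Lf.
have Lh := L2_conj_poisson_op1 d0 fi Lf.
under eq_Rintegral do rewrite mulrC.
apply: oppr_inj; rewrite -(conj_poisson_op_antisym e0 fi Lh) -mulNr.
(* The integrability of f P_(e+d) f is that of f Q_e Q_d f, which Fubini's theorem provided. *)
rewrite -RintegralZT; last first.
  have := integrableZT (- pi^-1) (Fubini_conj_poisson e0 fi Lh).1.
  congr (mu.-integrable _ _); apply/funext => x /=; congr EFin.
  have := pi_gt0 R; rewrite conj_poisson_op_comp //; move: (pi : R) => p p0.
  by field; rewrite gt_eqF.
by apply: eq_Rintegral => x _; rewrite conj_poisson_op_comp//; ring.
Qed.

(** |Q_d f|^2 = pi <f, P_(2d) f> = pi^2 <f, g>, where g = P_(2d) f / pi has norm at most |f|.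
    Writing [g] through Q_d Q_d f gives its measurability. *)
Lemma conj_poisson_op_bound1 d f : 0 < d -> intg f -> L2 mu f -> sqn (Q d f) <= pi ^+ 2 * sqn f.
Proof.
move=> d0 fi Lf.
have pi0 := pi_gt0 R.
have dd0 : 0 < d + d by exact: addr_gt0.
have Lh := L2_conj_poisson_op1 d0 fi Lf.
pose g x := - (pi ^- 2 * Q d (Q d f) x).
have gE x : pi * g x = poisson_op (d + d) f x.
  by move: pi0; rewrite /g conj_poisson_op_comp//; move: (pi : R) => p p0; field; rewrite gt_eqF.
have [Lg gf] : L2 mu g /\ sqn g <= sqn f.
  apply: poisson_contraction dd0 Lf _ gE; apply: measurableT_comp => //.
  by apply: measurable_funM; [exact: measurable_cst|exact: measurable_conj_poisson_op d0 Lh].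
have -> : sqn (Q d f) = pi ^+ 2 * \int[mu]_x (f x * g x).
  transitivity (\int[mu]_x (Q d f x * Q d f x)); first by apply: eq_Rintegral => x _; rewrite expr2.
  rewrite conj_poisson_op_inner// expr2 -mulrA -[in RHS]RintegralZT; last exact: L2_integrableM.
  by congr (_ * _); apply: eq_Rintegral => x _; rewrite -gE mulrCA.
rewrite ler_pM2l ?exprn_gt0//.
have := Cauchy_Schwarz Lf Lg.
set B := \int[mu]_x (f x * g x) => h.
apply: le_trans (ler_norm _) _; rewrite -(@ler_pXn2r _ 2)// ?nnegrE ?sqn_ge0//.
rewrite real_normK ?num_real//; apply: le_trans h _.
by rewrite [leRHS]expr2 ler_wpM2l// sqn_ge0.
Qed.

Lemma conj_poisson_op_linear d f g x (k : R) : 0 < d -> L2 mu f -> L2 mu g ->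
  Q d (fun y => f y + k * g y) x = Q d f x + k * Q d g x.
Proof.
move=> d0 Lf Lg; have Lq := (L2_conj_poisson x d0).1.
rewrite /conj_poisson_op -RintegralZT; last exact: L2_integrableM Lq Lg.
rewrite -RintegralDT; [|exact: L2_integrableM|exact/integrableZT/L2_integrableM].
by apply: eq_Rintegral => y _; ring.
Qed.

Lemma conj_poisson_op_cauchy1 f (eta : R) : intg f -> L2 mu f -> 0 < eta ->
  exists2 e0, 0 < e0 & forall e d, 0 < e <= e0 -> 0 < d <= e0 ->
    \int[mu]_x ((Q e f x - Q d f x) ^+ 2) <= eta.
Proof.
move=> fi Lf eta0.
pose N e := sqn (Q e f).
have Nle e d : 0 < e -> e <= d -> N d <= N e.
  move=> e0; rewrite le_eqVlt => /predU1P[->//|ed].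
  have de0 : 0 < d - e by rewrite subr_gt0.
  by have := conj_poisson_op_nonincreasing de0 e0 fi Lf; rewrite subrK.
pose A := [set N e | e in [set e | 0 < e]].
have hA : has_sup A.
  split; first by apply: (ex_intro _ (N 1)); exists 1 => //=; exact: ltr01.
  by exists (pi ^+ 2 * sqn f) => _ [e /= e0 <-]; exact: conj_poisson_op_bound1.
(* With N(e0) > sup A - eta / 2, the second difference N(e) + N(d) - 2 N(m) is at most 2 (sup A -
   N(e0)) < eta, since m <= e0 gives N(m) >= N(e0). *)
have [_ [e0 /= e00 <-] he0] := sup_adherent (divr_gt0 eta0 (ltr0n R 2)) hA.
exists e0 => // e d /andP[e0' ee0] /andP[d0 de0].
have N1 := L2_conj_poisson_op1 e0' fi Lf; have N2 := L2_conj_poisson_op1 d0 fi Lf.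
have -> : \int[mu]_x ((Q e f x - Q d f x) ^+ 2) = N e + N d - 2 * \int[mu]_x (Q e f x * Q d f x).
  have iM := L2_integrableM N1 N2.
  rewrite -RintegralZT// -RintegralDT; [|exact: N1.2|exact: N2.2].
  rewrite -RintegralBT; [|exact: (integrableDT N1.2 N2.2)|exact: integrableZT].
  by apply: eq_Rintegral => x _; ring.
pose m := (e + d) / 2.
have m0 : 0 < m by rewrite divr_gt0// addr_gt0.
have -> : \int[mu]_x (Q e f x * Q d f x) = N m.
  rewrite conj_poisson_op_inner// /N.
  transitivity (\int[mu]_x (Q m f x * Q m f x)); last by apply: eq_Rintegral => x _; rewrite expr2.
  have mm : m + m = e + d by rewrite /m; lra.
  by rewrite (conj_poisson_op_inner m0 m0 fi Lf) mm.
have up r : 0 < r -> N r <= sup A.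
  by move=> r0; apply: sup_upper_bound => //; exists r.
have lo : N e0 <= N m by apply: Nle => //; rewrite /m; lra.
have u1 := up e e0'; have u2 := up d d0; move: he0 u1 u2 lo; rewrite -/(N e0).
move: (N e) (N d) (N m) (N e0) (sup A) => a b c k s; lra.
Qed.

(** These truncations of an L^2 function are integrable, and they carry the estimates over to all of
    L^2. *)
Definition truncated f n x := f x * \1_(`[- n%:R, n%:R]%classic : set R) x.

Lemma truncated_cvg f x : truncated f n x @[n --> \oo] --> f x.
Proof.
apply: cvg_near_cst; apply: filterS (near_segment x) => n nx.
by rewrite /truncated indicE mem_set// mulr1.
Qed.

Lemma truncated_norm f n x : `|truncated f n x| <= `|f x|.
Proof. by rewrite /truncated normrM indicE; case: (_ \in _); rewrite ?normr1 ?normr0 ?mulr1// mulr0. Qed.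

Lemma L2_truncated f n : L2 mu f -> L2 mu (truncated f n).
Proof.
move=> Lf; apply: (@le_L2 _ _ _ mu _ f) => [|x|//]; last exact: truncated_norm.
by apply: measurable_funM; [exact: Lf.1|exact: measurable_indic].
Qed.

Lemma integrable_truncated f n : L2 mu f -> intg (truncated f n).
Proof.
move=> Lf; apply: L2_integrableM Lf _; split; first exact: measurable_indic.
have := @integrable_indic_itv R (- n%:R) n%:R true false.
congr (mu.-integrable _ _); apply/funext => x /=; congr EFin.
by rewrite indicE; case: (_ \in _); rewrite ?expr1n ?expr0n.
Qed.

Lemma truncated_cvgL2 f : L2 mu f -> \int[mu]_x ((truncated f n x - f x) ^+ 2) @[n --> \oo] --> 0.
Proof.
move=> Lf; have -> : 0 = \int[mu]_x (0 : R) :> R by rewrite /Rintegral integral0.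
apply: (@cvg_Rintegral_dominated _ _ _ mu _ _ (fun x => f x ^+ 2) _ _ Lf.2 _).2.
- by move=> n; apply: measurable_funX; apply: measurable_funB; [exact: (L2_truncated n Lf).1|exact: Lf.1].
- move=> x; have e0 : (f x - f x) ^+ 2 = 0 by rewrite subrr expr0n.
  rewrite -[X in _ --> X]e0; apply: cvg_sqr; apply: cvgB; last exact: cvg_cst.
  exact: truncated_cvg.
- move=> n x; rewrite /truncated indicE; case: (_ \in _).
    by rewrite mulr1 subrr expr0n normr0 sqr_ge0.
  by rewrite mulr0 sub0r sqrrN ger0_norm ?sqr_ge0.
Qed.

(** For fixed [x], Q_d f(x) is an inner product with an L^2 kernel, so the values on truncations
    converge pointwise and Fatou's lemma passes the bound to the limit. *)
Lemma conj_poisson_op_bound d f : 0 < d -> L2 mu f ->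
  L2 mu (Q d f) /\ sqn (Q d f) <= pi ^+ 2 * sqn f.
Proof.
move=> d0 Lf; have mQ := measurable_conj_poisson_op d0 Lf.
suff [h1 h2] : intg (fun x => Q d f x ^+ 2) /\ sqn (Q d f) <= pi ^+ 2 * sqn f by split.
apply: (@integrable_le_fatou _ _ _ mu (fun n x => Q d (truncated f n) x ^+ 2)).
- by move=> n; exact: (L2_conj_poisson_op1 d0 (integrable_truncated n Lf) (L2_truncated n Lf)).2.
- by move=> n x; exact: sqr_ge0.
- move=> x; apply: cvg_sqr; apply: L2_cvg_inner => //.
  + by move=> n; exact: L2_truncated.
  + exact: (L2_conj_poisson x d0).1.
  + exact: truncated_cvgL2.
- apply: nearW => n.
  apply: le_trans (conj_poisson_op_bound1 d0 (integrable_truncated n Lf) (L2_truncated n Lf)) _.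
  rewrite ler_pM2l ?exprn_gt0 ?pi_gt0//; apply: le_RintegralT; [exact: (L2_truncated n Lf).2|exact: Lf.2|].
  move=> x; rewrite -(real_normK (num_real (f x))) -(real_normK (num_real (truncated _ _ _))).
  by rewrite ler_sqr ?nnegrE ?truncated_norm.
Qed.

Lemma conj_poisson_op_cauchy f (eta : R) : L2 mu f -> 0 < eta ->
  exists2 e0, 0 < e0 & forall e d, 0 < e <= e0 -> 0 < d <= e0 ->
    \int[mu]_x ((Q e f x - Q d f x) ^+ 2) <= eta.
Proof.
move=> Lf eta0.
(* Chosen to give 12 pi^2 |g - f|^2 <= eta. The three-term estimate below is then at most 3 (eta / 8
   + 2 pi^2 |g - f|^2) <= 7 eta / 8. *)
have P0 : 0 < 4 * pi ^+ 2 * 3 + 4 :> R by have := sqr_ge0 (pi : R); lra.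
have c0 : 0 < eta / (4 * pi ^+ 2 * 3 + 4) by rewrite divr_gt0.
have [n] : exists n, \int[mu]_x ((truncated f n x - f x) ^+ 2) <= eta / (4 * pi ^+ 2 * 3 + 4).
  have := truncated_cvgL2 Lf; move=> /cvgrPdist_le /(_ _ c0) [n _ /(_ n (leqnn n))].
  by rewrite sub0r normrN ger0_norm ?sqn_ge0// => h; exists n.
set g := truncated f n => hg.
have Lg : L2 mu g by exact: L2_truncated.
have eta4 : 0 < eta / 8 by rewrite divr_gt0.
have [e0 e00 he0] := conj_poisson_op_cauchy1 (integrable_truncated n Lf) Lg eta4.
exists e0 => // e d eP dP; have := he0 e d eP dP.
case/andP: eP => e_gt0 _; case/andP: dP => d_gt0 _.
have LB : L2 mu (fun x => g x + (-1) * f x) by exact: L2D Lg (L2Z _ Lf).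
have b r : 0 < r -> L2 mu (fun x => Q r g x - Q r f x) /\
    \int[mu]_x ((Q r g x - Q r f x) ^+ 2) <= pi ^+ 2 * \int[mu]_x ((g x - f x) ^+ 2).
  move=> r0; have [h1 h2] := conj_poisson_op_bound r0 LB; split.
    move: h1; congr (L2 mu _); apply/funext => x.
    by rewrite conj_poisson_op_linear//; ring.
  apply: le_trans (le_trans h2 _).
    by rewrite le_eqVlt; apply/orP; left; apply/eqP; apply: eq_Rintegral => x _; rewrite conj_poisson_op_linear//; ring.
  rewrite le_eqVlt; apply/orP; left; apply/eqP; congr (_ * _).
  by apply: eq_Rintegral => x _; ring.
have [Be b1] := b e e_gt0; have [Bd b2] := b d d_gt0.
have Ba := L2B (conj_poisson_op_bound e_gt0 Lg).1 (conj_poisson_op_bound d_gt0 Lg).1.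
have Bf := L2B (conj_poisson_op_bound e_gt0 Lf).1 (conj_poisson_op_bound d_gt0 Lf).1.
move=> h3.
have h1 : \int[mu]_x ((Q e f x - Q d f x) ^+ 2) <= 3 * (\int[mu]_x ((Q e g x - Q d g x) ^+ 2) +
    \int[mu]_x ((Q e g x - Q e f x) ^+ 2) + \int[mu]_x ((Q d g x - Q d f x) ^+ 2)).
  have i2 := integrableDT Ba.2 Be.2; have i3 := integrableDT i2 Bd.2.
  rewrite -(RintegralDT Ba.2 Be.2) -(RintegralDT i2 Bd.2) -(RintegralZT _ i3).
  apply: le_RintegralT; [exact: Bf.2|exact: integrableZT|move=> x].
  set a := Q e g x - Q d g x; set be := Q e g x - Q e f x; set c := Q d g x - Q d f x.
  (* The difference on the left is a - be + c, and 3 (a^2 + be^2 + c^2) exceeds its square by these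
     three squares. *)
  rewrite -subr_ge0 (_ : _ - _ = (a + be) ^+ 2 + (a - c) ^+ 2 + (be + c) ^+ 2).
    by rewrite !addr_ge0// sqr_ge0.
  by rewrite /a /be /c; ring.
apply: le_trans h1 _.
move: hg; rewrite ler_pdivlMr//.
have p0 : 0 <= \int[mu]_x ((g x - f x) ^+ 2) by exact: sqn_ge0.
move: b1 b2 h3 p0.
move: (\int[mu]_x ((Q e g x - Q e f x) ^+ 2)) (\int[mu]_x ((Q d g x - Q d f x) ^+ 2))
  (\int[mu]_x ((Q e g x - Q d g x) ^+ 2)) (\int[mu]_x ((g x - f x) ^+ 2)) (pi ^+ 2 : R).
move=> a b' c s p b1 b2 h3 s0 h4.
have : 12 * (p * s) <= eta by lra.
lra.
Qed.
End conj_poisson_L2.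

(** * Poisson averages at Lebesgue points *)

Section lebesgue_points.
Context {R : realType}.
Local Notation mu := (@lebesgue_measure R).
Implicit Types (e d t x y z r : R) (f g h : R -> R).
Local Notation intg f := (mu.-integrable [set: R] (EFin \o f)).

Lemma indic_ballE x r y : \1_(ball x r) y = (`|x - y| < r)%R%:R :> R.
Proof.
rewrite indicE; have [xy|/negP xy] := boolP (`|x - y| < r); first by rewrite mem_set// -ball_normE.
by rewrite memNset// -ball_normE.
Qed.

Lemma L2_indic_ball x r : L2 mu (\1_(ball x r) : R -> R).
Proof.
have m : measurable_fun [set: R] (\1_(ball x r) : R -> R).
  by apply: measurable_indic; exact: measurable_ball.
split => //.
have [r0|r0] := leP r 0.
  have -> : (fun y => \1_(ball x r) y ^+ 2) = (fun=> 0 : R).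
    by apply/funext => y; rewrite indic_ballE ltNge (le_trans r0)//= expr0n.
  exact: integrable0.
have := @integrable_indic_itv R (x - r) (x + r) false true.
congr (mu.-integrable _ _); apply/funext => y /=; congr EFin.
rewrite -ball_itv indicE; case: (_ \in _); by rewrite ?expr1n ?expr0n.
Qed.

Lemma integrable_ball_dist f x r : L2 mu f ->
  intg (fun y => \1_(ball x r) y * `|f y - f x|).
Proof.
move=> Lf; have Lb := L2_indic_ball x r.
have ib : intg (\1_(ball x r) : R -> R).
  have := Lb.2; congr (mu.-integrable _ _); apply/funext => y /=; congr EFin.
  by rewrite indicE; case: (_ \in _); rewrite ?expr1n ?expr0n.
have := integrable_normT (integrableBT (L2_integrableM Lb Lf) (integrableZT (f x) ib)).
congr (mu.-integrable _ _); apply/funext => y /=; congr EFin.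
rewrite (mulrC (f x)) -mulrBr normrM; congr (_ * _).
by rewrite ger0_norm// indicE.
Qed.

(** The average multiplied by the length 2 r of the ball, with an indicator in place of the domain
    so that different balls can be summed. *)
Lemma lebesgue_pt_ball f x (eta : R) : L2 mu f -> lebesgue_pt f x -> 0 < eta ->
  exists2 r0, 0 < r0 & forall r, 0 < r < r0 ->
    \int[mu]_y (\1_(ball x r) y * `|f y - f x|) <= 2 * r * eta.
Proof.
move=> Lf lf eta0.
have : \forall r \near 0^'+, (davg f x r < eta%:E)%E.
  have eta0' : (0 < eta%:E)%E by rewrite lte_fin.
  exact: (lf _ (nbhs_open_ereal_lt eta0)). 
move=> [r0 /= r00 h]; exists r0 => // r /andP[r_gt0 rr0].
have := h r; rewrite /= sub0r normrN gtr0_norm// => /(_ rr0 r_gt0).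
rewrite /davg /iavg lebesgue_measure_ball; last exact: ltW.
have i1 := integrable_ball_dist x r Lf.
rewrite [X in (_ * X)%E](_ : _ =
   (\int[mu]_y (\1_(ball x r) y * `|f y - f x|))%:E); last first.
  rewrite integral_mkcond fineK; last exact: integrable_fin_num i1.
  apply: eq_integral => y _; rewrite patchE indicE.
  by case: (_ \in _); rewrite ?mul1r ?mul0r.
rewrite inver mulrn_eq0/= gt_eqF// -EFinM lte_fin mulrC ltr_pdivrMr.
  by move=> /ltW; rewrite mulrC mulr_natl.
by rewrite pmulrn_lgt0.
Qed.

Lemma integrable_poisson_dist f e x : 0 < e -> L2 mu f ->
  intg (fun y => poisson e (x - y) * `|f y - f x|).
Proof.
move=> e0 Lf; have Lp := L2_poisson x e0.
have := integrable_normT (integrableBT (L2_integrableM Lp Lf) (integrableZT (f x) (poisson_integral x e0).1)).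
congr (mu.-integrable _ _); apply/funext => y /=; congr EFin.
by rewrite (mulrC (f x)) -mulrBr normrM ger0_norm// poisson_ge0.
Qed.

Lemma expr4 k : 4 ^+ k = (2 ^+ k) ^+ 2 :> R.
Proof. by rewrite (_ : 4 = 2 ^+ 2 :> R) -?exprM 1?mulnC//; ring. Qed.

(** A step majorant of p_e: where 2^(k-1) e <= |x - y| < 2^k e, the kernel is at most e / (2^(k-1)
    e)^2 = 4 / (4^k e); in the innermost ball it is at most 1 / e. *)
Definition dyadic e x N y : R := \sum_(k < N.+1) 4 / (4 ^+ k * e) * \1_(ball x (2 ^+ k * e)) y.

Lemma dyadic_ge0 e x N y : 0 < e -> 0 <= dyadic e x N y.
Proof.
move=> e0; apply: sumr_ge0 => k _; rewrite mulr_ge0//.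
by rewrite divr_ge0// mulr_ge0 ?exprn_ge0// ltW.
Qed.

Lemma poisson_le_dyadic e x N y : 0 < e -> `|x - y| < 2 ^+ N * e ->
  poisson e (x - y) <= dyadic e x N y.
Proof.
move=> e0; elim: N => [|N ih] xy; rewrite /dyadic big_ord_recr/= indic_ballE xy mulr1.
  rewrite big_ord0 add0r expr0 mul1r.
  apply: le_trans (ler_norm _) (le_trans (poisson_bound _ e0) _).
  by rewrite ler_peMl ?invr_ge0 ?ler1n ?ltW.
have [/ih xy'|yx] := ltP `|x - y| (2 ^+ N * e).
  by apply: le_trans xy' _; rewrite lerDl divr_ge0// mulr_ge0 ?exprn_ge0// ltW.
apply: (@le_trans _ _ (4 / (4 ^+ N.+1 * e))); last by rewrite lerDr; exact: dyadic_ge0.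
have N0 : 0 < 2 ^+ N :> R by rewrite exprn_gt0.
have t0 : 0 < `|x - y| by apply: lt_le_trans yx; rewrite mulr_gt0.
rewrite /poisson -(real_normK (num_real (x - y))).
have -> : 4 / (4 ^+ N.+1 * e) = e / (2 ^+ N * e) ^+ 2.
  rewrite exprS expr4.
  by field; rewrite !gt_eqF.
rewrite ler_pM2l// lef_pV2 ?posrE ?exprn_gt0 ?addr_gt0 ?exprn_gt0 ?mulr_gt0//.
rewrite ler_wpDr ?sqr_ge0// ler_sqr// nnegrE; apply: ltW => //; exact: mulr_gt0.
Qed.

(** The k-th ball contributes 8 eta / 2^k, and the geometric sum is bounded independently of [e] and
    [N]. *)
Lemma dyadic_integral f e x N (eta : R) : 0 < e -> L2 mu f ->
  (forall k, (k <= N)%N ->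
    \int[mu]_y (\1_(ball x (2 ^+ k * e)) y * `|f y - f x|) <= 2 * (2 ^+ k * e) * eta) ->
  intg (fun y => dyadic e x N y * `|f y - f x|) /\
  \int[mu]_y (dyadic e x N y * `|f y - f x|) <= (16 - 8 / 2 ^+ N) * eta.
Proof.
move=> e0 Lf.
have c k : (\int[mu]_y (\1_(ball x (2 ^+ k * e)) y * `|f y - f x|) <= 2 * (2 ^+ k * e) * eta) ->
    4 / (4 ^+ k * e) * \int[mu]_y (\1_(ball x (2 ^+ k * e)) y * `|f y - f x|) <= 8 / 2 ^+ k * eta.
  have k0 : 0 < 2 ^+ k :> R by rewrite exprn_gt0.
  have E : 4 ^+ k = (2 ^+ k) ^+ 2 :> R by rewrite expr4.
  have p : 0 < 4 / (4 ^+ k * e) by rewrite E divr_gt0// mulr_gt0// exprn_gt0.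
  move=> h; apply: le_trans (ler_wpM2l (ltW p) h) _.
  rewrite E le_eqVlt; apply/orP; left; apply/eqP.
  by field; rewrite !gt_eqF.
have ib k := integrableZT (4 / (4 ^+ k * e)) (integrable_ball_dist x (2 ^+ k * e) Lf).
elim: N => [|N ih] hN.
  have E : (fun y => dyadic e x 0 y * `|f y - f x|) =
      (fun y => 4 / (4 ^+ 0 * e) * (\1_(ball x (2 ^+ 0 * e)) y * `|f y - f x|)).
    by apply/funext => y; rewrite /dyadic big_ord_recr big_ord0/= add0r mulrA.
  rewrite E; split; first exact: ib.
  rewrite RintegralZT; last exact: integrable_ball_dist.
  apply: le_trans (c 0%N (hN 0%N (leqnn _))) _.
  by rewrite expr0 divr1 (_ : 16 - 8 = 8 :> R)//; ring.
have [|i1 l1] := ih; first by move=> k kN; apply: hN; exact: leqW.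
have E : (fun y => dyadic e x N.+1 y * `|f y - f x|) = (fun y => dyadic e x N y * `|f y - f x| +
    4 / (4 ^+ N.+1 * e) * (\1_(ball x (2 ^+ N.+1 * e)) y * `|f y - f x|)).
  by apply/funext => y; rewrite /dyadic big_ord_recr/= mulrDl mulrA.
rewrite E; split; first exact: integrableDT (ib _).
rewrite RintegralDT// RintegralZT; last exact: integrable_ball_dist.
apply: le_trans (lerD l1 (c _ (hN _ (leqnn _)))) _.
have N0 : 0 < 2 ^+ N :> R by rewrite exprn_gt0.
rewrite le_eqVlt; apply/orP; left; apply/eqP; rewrite exprS; field; by rewrite gt_eqF.
Qed.

(** For t >= r one has (t^2 + 1) / t^2 <= 1 + r^-2. The factor [e] makes the far part vanish in the
    limit, against a fixed integrable majorant. *)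
Lemma poisson_far e x y r : 0 < e -> 0 < r -> r <= `|x - y| ->
  poisson e (x - y) <= e * (1 + r ^- 2) * poisson 1 (x - y).
Proof.
move=> e0 r0 rxy; have t0 := lt_le_trans r0 rxy.
rewrite /poisson -(real_normK (num_real (x - y))) -mulrA ler_pM2l// expr1n mul1r.
set t := `|x - y| in rxy t0 *.
have h1 : 0 < t ^+ 2 + 1 by rewrite ltr_wpDl ?sqr_ge0.
rewrite ler_pdivlMr// mulrC ler_pdivrMr; last exact: sqrD_gt0.
have tr : 1 <= r ^- 2 * t ^+ 2.
  by rewrite mulrC ler_pdivlMr ?exprn_gt0// mul1r; apply: lerXn2r => //; rewrite nnegrE; exact: ltW.
have r2 : 0 <= r ^- 2 by rewrite invr_ge0 exprn_ge0// ltW.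
have e2 := sqr_ge0 e.
rewrite mulrDl mul1r mulrDr; have := mulr_ge0 r2 e2; lra.
Qed.

Lemma cvg_poisson_lebesgue_pt f x : L2 mu f -> lebesgue_pt f x ->
  \int[mu]_y (poisson e (x - y) * `|f y - f x|) @[e --> 0^'+] --> 0.
Proof.
move=> Lf lf; apply/cvgrPdist_le => eta eta0.
(* The dyadic part then contributes at most 16 eta / 32 = eta / 2, which leaves eta / 2 for the far
   part. *)
have eta32 : 0 < eta / 32 by rewrite divr_gt0.
have [r0 r00 hr0] := lebesgue_pt_ball Lf lf eta32.
(* The least power with r <= 2^N e satisfies 2^N e < 2 r = r0 / 2, so every dyadic ball used has
   radius below [r0]. *)
pose r := r0 / 4.
have rp : 0 < r by rewrite divr_gt0.
pose C := (1 + r ^- 2) * \int[mu]_y (poisson 1 (x - y) * `|f y - f x|).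
have i1 := integrable_poisson_dist x ltr01 Lf.
have C0 : 0 <= C.
  rewrite mulr_ge0 ?addr_ge0 ?invr_ge0 ?sqr_ge0//.
  by apply: Rintegral_ge0 => y _; rewrite mulr_ge0 ?poisson_ge0.
near=> e.
have e0 : 0 < e by near: e; exact: nbhs_right_gt.
have er : e < r by near: e; exact: nbhs_right_lt.
have eC : e < eta / (2 * (C + 1)).
  by near: e; apply: nbhs_right_lt; rewrite divr_gt0// mulr_gt0// ltr_pwDr.
rewrite sub0r normrN ger0_norm; last first.
  by apply: Rintegral_ge0 => y _; rewrite mulr_ge0 ?poisson_ge0.
have exN : exists N, r <= 2 ^+ N * e.
  exists (Num.truncn (r / e)).+1; rewrite -ler_pdivrMr//.
  apply: le_trans (ltW (truncnS_gt _)) _; rewrite -natrX ler_nat.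
  exact/ltnW/ltn_expl.
case: (ex_minnP exN) => -[|N] rN minN.
  by move: rN; rewrite expr0 mul1r leNgt er.
have Nr : 2 ^+ N * e < r by rewrite ltNge; apply/negP => /minN; rewrite ltnn.
have [|id ld] := @dyadic_integral f e x N.+1 (eta / 32) e0 Lf.
  move=> k kN; apply: hr0; rewrite mulr_gt0 ?exprn_gt0//=.
  apply: (@le_lt_trans _ _ (2 ^+ N.+1 * e)).
    by rewrite ler_pM2r// ler_weXn2l// ler1n.
  by rewrite exprS -mulrA /r in Nr *; lra.
have ie := integrable_poisson_dist x e0 Lf.
have ic := integrableZT (e * (1 + r ^- 2)) i1.
apply: le_trans (le_RintegralT ie (integrableDT id ic) _) _.
  move=> y; have d0 := dyadic_ge0 x N.+1 y e0.
  rewrite mulrA -mulrDl ler_wpM2r//.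
  have [xy|yx] := ltP `|x - y| (2 ^+ N.+1 * e).
    apply: le_trans (poisson_le_dyadic e0 xy) _; rewrite lerDl; apply: mulr_ge0; last exact: poisson_ge0.
    by apply: mulr_ge0; [exact: ltW|apply: addr_ge0 => //; rewrite invr_ge0 sqr_ge0].
  by apply: le_trans (poisson_far e0 rp (le_trans rN yx)) _; rewrite lerDr.
rewrite RintegralDT// RintegralZT// -mulrA -/C.
have : e * C <= eta / 2.
  apply: le_trans (ler_wpM2r C0 (ltW eC)) _.
  rewrite [leLHS](_ : _ = (eta / 2) * (C / (C + 1))); last by field; rewrite gt_eqF// ltr_pwDr.
  apply: ler_piMr; first by rewrite divr_ge0// ltW.
  by rewrite ler_pdivrMr ?ltr_pwDr// mul1r lerDl.
have : 0 <= 8 / 2 ^+ N.+1 * (eta / 32) by apply: mulr_ge0; [rewrite divr_ge0// exprn_ge0|exact: ltW].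
move: ld; rewrite mulrBl; lra.
Unshelve. all: by end_near. Qed.
End lebesgue_points.

(** * Almost everywhere convergence of the truncated Hilbert integrals *)

Section principal_values.
Context {R : realType}.
Local Notation mu := (@lebesgue_measure R).
Implicit Types (e d t x y z r : R) (f g h : R -> R).
Local Notation intg f := (mu.-integrable [set: R] (EFin \o f)).
Local Notation Q := conj_poisson_op.
Local Notation sqn f := (\int[mu]_x (f x ^+ 2)).

(** The image of Lebesgue measure under y |-> x - y gives ]a, b] the length of [x - b, x - a[, so it
    is Lebesgue measure by uniqueness. *)
Lemma Rintegral_reflect x f : measurable_fun [set: R] f -> intg (fun y => f (x - y)) ->
  \int[mu]_y f (x - y) = \int[mu]_y f y.
Proof.
move=> mf fi.
pose phi := (fun y => x - y) : measurableTypeR R -> measurableTypeR R.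
have mphi : measurable_fun [set: measurableTypeR R] phi.
  by apply: continuous_measurable_fun => y; apply: cvgB; [exact: cvg_cst|exact: cvg_id].
have E A : measurable A -> mu A = pushforward mu phi A.
  apply: lebesgue_measure_unique => _ [[a b] _ <-]/=.
  rewrite /pushforward.
  have -> : phi @^-1` `]a, b] = `[x - b, x - a[%classic.
    apply/seteqP; split => y /=; rewrite !in_itv/= /phi => /andP[h1 h2]; apply/andP;
    by split; rewrite ?lerBlDr -?lerBlDl// ltrBrDr -ltrBrDl.
  rewrite !lebesgue_measure_itv/= !lte_fin ltrD2l ltrN2; case: ifP => // _.
  by rewrite -EFinB; congr EFin; lra.
rewrite /Rintegral; congr fine.
rewrite [RHS](@eq_measure_integral _ _ _ _ (pushforward mu phi))//; last by move=> A mA _; exact: E.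
rewrite integral_pushforward//.
exact/measurable_EFinP.
Qed.

Lemma cvg_harmonicV : (n.+1%:R^-1 : R) @[n --> \oo] --> (0 : R).
Proof. exact: cvg_harmonic. Qed.

(** In P_e Q_d f = pi Q_(e+d) f let d tend to 0 at a fixed point: the left side is an inner product
    with an L^2 kernel, and the right side is dominated because |q_(e+d)| <= |q_e|. The resulting
    identity holds at every [x]. *)
Lemma conj_poisson_op_limit f : L2 mu f -> exists g, [/\ L2 mu g,
  \int[mu]_x ((Q n.+1%:R^-1 f x - g x) ^+ 2) @[n --> \oo] --> 0 &
  forall e x, 0 < e -> pi * Q e f x = poisson_op e g x].
Proof.
move=> Lf.
pose dn n : R := n.+1%:R^-1.
have d0 n : 0 < dn n by rewrite invr_gt0.
have LQ n : L2 mu (Q (dn n) f) by exact: (conj_poisson_op_bound (d0 n) Lf).1.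
have [|g Lg gE] := @L2_complete _ _ _ mu (fun n => Q (dn n) f) LQ.
  move=> e e0; have [e1 e10 h] := conj_poisson_op_cauchy Lf e0.
  have : \forall n \near \oo, dn n <= e1.
    by apply: (cvgr_le _ cvg_harmonicV).
  move=> [N _ NP]; exists N => m n Nm Nn.
  by apply: h; rewrite d0 /=; [exact: NP m Nm|exact: NP n Nn].
exists g; split => // e x e0.
have c1 : poisson_op e (Q (dn n) f) x @[n --> \oo] --> poisson_op e g x.
  exact: L2_cvg_inner LQ (L2_poisson x e0) Lg gE.
have c2 : poisson_op e (Q (dn n) f) x @[n --> \oo] --> pi * Q e f x.
  rewrite (eq_cvg _ _ (fun n => poisson_conj_poisson_op x e0 (d0 n) Lf)).
  apply: cvgM; first exact: cvg_cst.
  apply: (@cvg_Rintegral_dominated _ _ _ mu _ _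
    (fun y => `|conj_poisson e (x - y) * f y|) _ _ _ _).2.
  - move=> n; apply: integrable_measurable.
    exact: L2_integrableM (L2_conj_poisson x (addr_gt0 e0 (d0 n))).1 Lf.
  - move=> y; apply: cvgM; last exact: cvg_cst.
    apply: cvgM; first exact: cvg_cst.
    apply: cvgV; first by rewrite gt_eqF// sqrD_gt0.
    apply: cvgD; first exact: cvg_cst.
    apply: cvg_sqr; rewrite -[X in _ --> X]addr0; apply: cvgD; first exact: cvg_cst.
    exact: cvg_harmonicV.
  - by apply: integrable_normT; exact: L2_integrableM (L2_conj_poisson x e0).1 Lf.
  - move=> n y; rewrite /= !normrM; apply: ler_wpM2r => //.
    apply: ler_wpM2l => //; rewrite !normfV.
    have h1 := sqrD_gt0 (x - y) e0; have h2 := sqrD_gt0 (x - y) (addr_gt0 e0 (d0 n)).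
    rewrite !gtr0_norm// lef_pV2 ?posrE// lerD2l.
    by apply: lerXn2r; rewrite ?nnegrE ?lerDl; apply: ltW => //; exact: addr_gt0.
exact: cvg_unique c2 c1.
Qed.

(** The inverse is the pointwise limit of conjugate Poisson kernels, even at 0, thanks to the
    convention [0^-1 = 0]. *)
Lemma measurable_inv_fun : measurable_fun [set: R] (fun t : R => t^-1).
Proof.
apply: (@measurable_fun_cvg _ _ _ _ (fun n => conj_poisson n.+1%:R^-1)).
  by move=> n; apply: measurable_conj_poisson; rewrite invr_gt0.
move=> t _; have [->|t0] := eqVneq t 0.
  by rewrite invr0; under eq_cvg do rewrite /conj_poisson mul0r; exact: cvg_cst.
rewrite (_ : t^-1 = t / (t ^+ 2 + 0 ^+ 2)); last by field.
apply: cvgM; first exact: cvg_cst.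
apply: cvgV; first by rewrite expr0n addr0 expf_neq0.
apply: cvgD; first exact: cvg_cst.
by apply: cvg_sqr; exact: cvg_harmonicV.
Qed.

Definition truncated_inv e t : R := if e < `|t| then t^-1 else 0.

Lemma measurable_truncated_inv e : measurable_fun [set: R] (truncated_inv e).
Proof.
rewrite (_ : truncated_inv e = (fun t => (1 - \1_(`[- e, e]%classic : set R) t) * t^-1)).
  apply: measurable_funM; last exact: measurable_inv_fun.
  by apply: measurable_funB; [exact: measurable_cst|exact: measurable_indic].
apply/funext => t; rewrite /truncated_inv indicE ltNge.
have -> : (t \in `[- e, e]%classic) = (`|t| <= e) by rewrite mem_setE in_itv/= ler_norml.
by case: (_ <= _); rewrite /= ?subrr ?mul0r// subr0 mul1r.
Qed.

Lemma truncated_invN e t : truncated_inv e (- t) = - truncated_inv e t.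
Proof. by rewrite /truncated_inv normrN; case: ifP; rewrite ?oppr0// invrN. Qed.

(** For |t| > e the difference is e^2 / (t (t^2 + e^2)), that is p_e(t) times e / t; otherwise it is
    -q_e(t), with |t| <= e. *)
Lemma truncated_inv_sub_le e t : 0 < e ->
  `|truncated_inv e t - conj_poisson e t| <= poisson e t.
Proof.
move=> e0; have h := sqrD_gt0 t e0; rewrite /truncated_inv; case: ltP => et.
  have t0 : 0 < `|t| by exact: lt_trans et.
  have t1 : t != 0 by rewrite -normr_gt0.
  rewrite /conj_poisson (_ : _ - _ = t^-1 * (e * e / (t ^+ 2 + e ^+ 2))); last first.
    by field; rewrite gt_eqF.
  have D0 : 0 <= e * e / (t ^+ 2 + e ^+ 2) by rewrite -expr2 divr_ge0 ?sqr_ge0// ltW.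
  rewrite normrM (ger0_norm D0) normfV.
  rewrite /poisson -(mulrA e) [leLHS]mulrA; apply: ler_piMl; first by rewrite divr_ge0 ?ltW.
  by rewrite mulrC ler_pdivrMr// mul1r ltW.
rewrite sub0r normrN /conj_poisson /poisson normrM normfV (gtr0_norm h).
by rewrite ler_pM2r ?invr_gt0.
Qed.

Lemma measurable_truncated_inv_shift e x :
  measurable_fun [set: R] (fun y => truncated_inv e (x - y)).
Proof.
apply: (measurableT_comp (measurable_truncated_inv e)).
by apply: measurable_funB; [exact: measurable_cst|exact: measurable_id].
Qed.

Let kappa e t := truncated_inv e t - conj_poisson e t.

(** Oddness, by two reflections: one removes the shift by [x], the other changes the sign. The
    vanishing integral allows [f x] to be subtracted from [f] under the integral. *)
Lemma kappa_integral e x : 0 < e -> intg (fun y => kappa e (x - y)) /\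
  \int[mu]_y kappa e (x - y) = 0.
Proof.
move=> e0.
have mk : measurable_fun [set: R] (kappa e).
  by apply: measurable_funB; [exact: measurable_truncated_inv|exact: measurable_conj_poisson].
have ik z : intg (fun y => kappa e (z - y)).
  apply: le_integrableT (poisson_integral z e0).1.
    apply: measurable_funB; first exact: measurable_truncated_inv_shift.
    exact: (L2_conj_poisson z e0).1.1.
  by move=> y; exact: truncated_inv_sub_le.
split => //.
rewrite Rintegral_reflect//.
have := @Rintegral_reflect 0 (kappa e) mk (ik 0).
have kN y : kappa e (0 - y) = - kappa e y.
  by rewrite sub0r /kappa truncated_invN conj_poissonN; ring.
under eq_Rintegral do rewrite kN.
rewrite RintegralNT; lra.
Qed.

Lemma L2_truncated_inv e x : 0 < e -> L2 mu (fun y => truncated_inv e (x - y)).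
Proof.
move=> e0; have Lk : L2 mu (fun y => kappa e (x - y)).
  apply: (@le_L2 _ _ _ mu _ (fun y => poisson e (x - y))); last exact: L2_poisson.
    exact: integrable_measurable (kappa_integral x e0).1.
  by move=> y; rewrite [leRHS]ger0_norm ?poisson_ge0// truncated_inv_sub_le.
have := L2D Lk (L2_conj_poisson x e0).1.
by congr (L2 mu _); apply/funext => y; rewrite /kappa; ring.
Qed.

Lemma truncated_hilbertE e f x :
  \int[mu]_(y in [set y | e < `|x - y|]) (f y / (x - y)) =
  \int[mu]_y (truncated_inv e (x - y) * f y).
Proof.
rewrite Rintegral_mkcond; apply: eq_Rintegral => y _.
rewrite patchE /truncated_inv; case: ifPn => [|/negP xy]; first by rewrite inE/= => ->; rewrite mulrC.
by rewrite ifF ?mul0r//; apply/negP => h; apply: xy; rewrite inE.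
Qed.

(** The truncated integral minus g(x) is the integral of kappa_e (f - f(x)) plus 1 / pi times that
    of p_e (g - g(x)). Both are dominated by Poisson averages which vanish at Lebesgue points. *)
Lemma cvg_truncated_hilbert f g x : L2 mu f -> L2 mu g ->
  (forall e, 0 < e -> pi * Q e f x = poisson_op e g x) ->
  lebesgue_pt f x -> lebesgue_pt g x ->
  \int[mu]_(y in [set y | e < `|x - y|]) (f y / (x - y)) @[e --> 0^'+] --> g x.
Proof.
move=> Lf Lg QP lf lg.
have cf := cvg_poisson_lebesgue_pt Lf lf; have cg := cvg_poisson_lebesgue_pt Lg lg.
have pi0 := pi_gt0 R.
under eq_cvg do rewrite truncated_hilbertE.
pose B e := \int[mu]_y (poisson e (x - y) * `|f y - f x|) +
  pi^-1 * \int[mu]_y (poisson e (x - y) * `|g y - g x|).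
have cB : B e @[e --> 0^'+] --> 0.
  rewrite -[X in _ --> X]addr0 -[X in _ + X](mulr0 pi^-1).
  by apply: cvgD => //; apply: cvgM => //; exact: cvg_cst.
have le_B e : 0 < e -> `|\int[mu]_y (truncated_inv e (x - y) * f y) - g x| <= B e.
  move=> e0; have [ik k0] := kappa_integral x e0.
  have [ip pE] := poisson_integral x e0.
  have Lq := (L2_conj_poisson x e0).1; have Lt := L2_truncated_inv x e0.
  have Lk : L2 mu (fun y => kappa e (x - y)) by exact: L2B.
  have Lp := L2_poisson x e0.
  have ikf := L2_integrableM Lk Lf; have iqf := L2_integrableM Lq Lf.
  have ipg := L2_integrableM Lp Lg.
  have E1 : \int[mu]_y (truncated_inv e (x - y) * f y) =
      \int[mu]_y (kappa e (x - y) * (f y - f x)) + Q e f x.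
    have -> : \int[mu]_y (kappa e (x - y) * (f y - f x)) = \int[mu]_y (kappa e (x - y) * f y).
      transitivity (\int[mu]_y (kappa e (x - y) * f y - f x * kappa e (x - y))).
        by apply: eq_Rintegral => y _; ring.
      by rewrite RintegralBT//; [rewrite RintegralZT// k0 mulr0 subr0|exact: integrableZT].
    rewrite /conj_poisson_op -RintegralDT//.
    by apply: eq_Rintegral => y _; rewrite /kappa; ring.
  have E2 : Q e f x - g x = pi^-1 * \int[mu]_y (poisson e (x - y) * (g y - g x)).
    have -> : \int[mu]_y (poisson e (x - y) * (g y - g x)) = poisson_op e g x - g x * pi.
      rewrite /poisson_op -pE -RintegralZT// -RintegralBT//; last exact: integrableZT.
      by apply: eq_Rintegral => y _; ring.
    by rewrite -QP// (mulrC (g x)) -mulrBr mulKf// gt_eqF.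
  rewrite E1 -addrA E2; apply: le_trans (ler_normD _ _) _; apply: lerD.
    have ik' : intg (fun y => kappa e (x - y) * (f y - f x)).
      have := integrableBT ikf (integrableZT (f x) ik).
      by congr (mu.-integrable _ _); apply/funext => y /=; congr EFin; ring.
    apply: le_trans (le_normr_Rintegral measurableT ik') _.
    apply: le_RintegralT; [exact: integrable_normT|exact: integrable_poisson_dist|].
    by move=> y; rewrite normrM ler_wpM2r// truncated_inv_sub_le.
  rewrite normrM gtr0_norm ?invr_gt0// ler_pM2l ?invr_gt0//.
  have ip' : intg (fun y => poisson e (x - y) * (g y - g x)).
    have := integrableBT ipg (integrableZT (g x) ip).
    by congr (mu.-integrable _ _); apply/funext => y /=; congr EFin; ring.
  apply: le_trans (le_normr_Rintegral measurableT ip') _.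
  apply: le_RintegralT; [exact: integrable_normT|exact: integrable_poisson_dist|].
  by move=> y; rewrite normrM ger0_norm// poisson_ge0.
apply/cvgrPdist_le => eta eta0.
move/cvgr0Pnorm_le : cB => /(_ _ eta0) cB.
near=> e; rewrite distrC; apply: le_trans (le_B e _) _; first by near: e; exact: nbhs_right_gt.
by apply: le_trans (ler_norm _) _; near: e.
Unshelve. all: by end_near. Qed.

Lemma L2_locally_integrable f : L2 mu f -> locally_integrable setT f.
Proof.
move=> Lf; split; [exact: Lf.1|exact: openT|move=> K _ cK].
have mK : measurable K by exact: compact_measurable.
have iK : mu.-integrable K (EFin \o (fun x => f x ^+ 2 + 1)).
  apply: (@integrableD _ _ _ mu K mK (EFin \o (fun x => f x ^+ 2)) (cst 1%E)).
    exact: integrableS (Lf.2).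
  apply/integrableP; split; first exact: measurable_cst.
  rewrite (eq_integral (cst 1%E)); last by move=> ? _; rewrite /= normr1.
  by rewrite integral_cst// mul1e; exact: compact_finite_measure.
have /integrableP[_] : mu.-integrable K (EFin \o f).
  apply: le_integrable iK => //.
    by apply/measurable_EFinP; apply: measurable_funTS; exact: Lf.1.
  move=> x _ /=; rewrite lee_fin [leRHS]ger0_norm ?addr_ge0 ?sqr_ge0//.
  by rewrite ler_norml; apply/andP; split; have := sqr_ge0 (f x - 1); have := sqr_ge0 (f x + 1); nra.
by [].
Qed.

(** One function [g] is both limits: the almost everywhere limit identifies the principal value, and
    the L^2 limit transfers antisymmetry to it. *)
Theorem truncated_hilbert_ae f : L2 mu f -> exists g, [/\ L2 mu g,
  \int[mu]_x ((Q n.+1%:R^-1 f x - g x) ^+ 2) @[n --> \oo] --> 0 &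
  {ae mu, forall x,
    \int[mu]_(y in [set y | e < `|x - y|]) (f y / (x - y)) @[e --> 0^'+] --> g x}].
Proof.
move=> Lf; have [g [Lg Qg QP]] := conj_poisson_op_limit Lf.
exists g; split => //.
apply: aeS2 (lebesgue_differentiation (L2_locally_integrable Lf))
  (lebesgue_differentiation (L2_locally_integrable Lg)) => x lf lg.
by apply: cvg_truncated_hilbert => // e; exact: QP.
Qed.

(** Used with [f] the derivative of the test function and [h] equal to [u]; the integrability of the
    former is what Fubini's theorem requires at each stage. *)
Lemma conj_poisson_limit_antisym f h gf gh : intg f -> L2 mu f -> L2 mu h ->
  L2 mu gf -> L2 mu gh ->
  \int[mu]_x ((Q n.+1%:R^-1 f x - gf x) ^+ 2) @[n --> \oo] --> 0 ->
  \int[mu]_x ((Q n.+1%:R^-1 h x - gh x) ^+ 2) @[n --> \oo] --> 0 ->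
  \int[mu]_x (f x * gh x) = - \int[mu]_x (h x * gf x).
Proof.
move=> fi Lf Lh Lgf Lgh cf ch.
have d0 n : 0 < n.+1%:R^-1 :> R by rewrite invr_gt0.
have LQ k n : L2 mu k -> L2 mu (Q n.+1%:R^-1 k) by move=> Lk; exact: (conj_poisson_op_bound (d0 n) Lk).1.
have c1 := L2_cvg_inner (fun n => LQ h n Lh) Lf Lgh ch.
have c2 : (- \int[mu]_x (h x * Q n.+1%:R^-1 f x)) @[n --> \oo] --> (- \int[mu]_x (h x * gf x)).
  exact: cvgN (L2_cvg_inner (fun n => LQ f n Lf) Lh Lgf cf).
have E : (fun n => \int[mu]_x (f x * Q n.+1%:R^-1 h x)) =
    (fun n => - \int[mu]_x (h x * Q n.+1%:R^-1 f x)).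
  by apply/funext => n; exact: conj_poisson_op_antisym (d0 n) fi Lh.
by move: c1; rewrite E => c1; exact: cvg_unique c1 c2.
Qed.
End principal_values.

(** * The half-Laplacian of a Schwartz function *)

Section schwartz.
Context {R : realType}.
Local Notation mu := (@lebesgue_measure R).
Implicit Types (e d t x y z r : R) (f g h phi : R -> R).
Local Notation intg f := (mu.-integrable [set: R] (EFin \o f)).

Lemma schwartz_is_derive phi x : is_schwartz phi -> is_derive x 1 phi ((derive1 phi) x).
Proof. by move=> [/(_ 0%N x) d _]; split => //; rewrite derive1E. Qed.

Lemma schwartz_continuous_derive phi : is_schwartz phi -> continuous (derive1 phi).
Proof.
move=> [/(_ 1%N) d _] x; exact/differentiable_continuous/derivable1_diffP/(d x).
Qed.

Lemma schwartz_continuous phi : is_schwartz phi -> continuous phi.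
Proof.
move=> [/(_ 0%N) d _] x; exact/differentiable_continuous/derivable1_diffP/(d x).
Qed.

(** The seminorm bounds for x^0 and x^2 add up to a multiple of 1 / (1 + x^2), which is p_1. *)
Lemma schwartz_derive_le phi : is_schwartz phi ->
  exists C, forall x, `|(derive1 phi) x| <= C * poisson 1 (0 - x).
Proof.
move=> [_ b]; have [C0 h0] := b 0%N 1%N; have [C2 h2] := b 2%N 1%N.
exists (C0 + C2) => x; have h := sqrD_gt0 (0 - x) (ltr01 : 0 < 1 :> R).
rewrite /poisson mulrA mulr1 ler_pdivlMr// mulrDr.
have := h0 x; have := h2 x; rewrite /= expr0 mul1r real_normK ?num_real// => k2 k0.
by rewrite expr1n mulr1 sub0r sqrrN addrC lerD// mulrC.
Qed.

Lemma schwartz_derive_integrable phi : is_schwartz phi ->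
  intg (derive1 phi) /\ L2 mu (derive1 phi).
Proof.
move=> sphi; have [C hC] := schwartz_derive_le sphi.
have m : measurable_fun [set: R] (derive1 phi).
  by apply: continuous_measurable_fun; exact: schwartz_continuous_derive.
split.
  exact: le_integrableT (integrableZT C (poisson_integral 0 ltr01).1).
apply: (@le_L2 _ _ _ mu _ (fun x => C * poisson 1 (0 - x))) => //.
  by move=> x; apply: le_trans (hC x) (ler_norm _).
exact/L2Z/L2_poisson.
Qed.

Lemma schwartz_bounded phi : is_schwartz phi -> exists C, forall x, `|phi x| <= C.
Proof.
move=> [_ b]; have [C0 h0] := b 0%N 0%N; exists C0 => x.
by have := h0 x; rewrite expr0 mul1r.
Qed.

(** These are the boundary terms of the integration by parts. They tend to -phi'(x) and phi'(x), and
    cancel because the excised interval is symmetric. *)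
Lemma cvg_schwartz_quotient phi x : is_schwartz phi ->
  ((phi x - phi (x + e)) / e + (phi x - phi (x - e)) / e) @[e --> 0^'+] --> 0.
Proof.
move=> sphi; have [d E] := schwartz_is_derive x sphi.
have c : (fun t : R => t^-1 * (phi (t + x) - phi x)) @ 0^' --> derive1 phi x.
  rewrite -E; move: d; rewrite /derivable /derive.
  by under eq_fun do rewrite -[(_ *: 1)%R]/(_ * 1)%R mulr1.
have right_dnbhs : (0 : R)^'+ `=>` 0^'.
  by move=> A [r /= r0 rA]; exists r => //= t tr t0; apply: rA => //=; rewrite gt_eqF.
have c1 : ((e^-1 * (phi (e + x) - phi x)) @[e --> 0^'+] --> derive1 phi x)%R.
  exact: cvg_trans (cvg_app _ right_dnbhs) c.
have c2 : (((- e)^-1 * (phi (- e + x) - phi x)) @[e --> 0^'+] --> derive1 phi x)%R.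
  apply: cvg_trans c => A [r /= r0 rA]; exists r => //= t tr t0.
  apply: (rA (- t)) => /=; last by rewrite oppr_eq0 gt_eqF.
  by move: tr; rewrite /= !sub0r !normrN.
have -> : (fun e => (phi x - phi (x + e)) / e + (phi x - phi (x - e)) / e) =
    (fun e => - (e^-1 * (phi (e + x) - phi x)) + (- e)^-1 * (phi (- e + x) - phi x)).
  by apply/funext => e; rewrite (addrC e) (addrC (- e)) invrN; ring.
rewrite -[X in _ --> X](addNr (derive1 phi x)); exact: cvgD (cvgN c1) c2.
Qed.

(** The difference of the two integrands is the derivative of [F], the difference quotient of phi at
    x. Its values at x - e and x + e give the boundary terms, and it vanishes at infinity because
    phi is bounded. *)
Lemma half_laplacian_by_parts phi x e : is_schwartz phi -> 0 < e ->
  \int[mu]_(y in [set y | e < `|x - y|]) ((phi x - phi y) / `|x - y| ^+ 2) =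
  (phi x - phi (x + e)) / e + (phi x - phi (x - e)) / e +
  \int[mu]_(y in [set y | e < `|x - y|]) ((derive1 phi) y / (x - y)).
Proof.
move=> sphi e0.
have [_ Lpsi] := schwartz_derive_integrable sphi.
have [C hC] := schwartz_bounded sphi.
have Lt := L2_truncated_inv x e0.
have mphi : measurable_fun [set: R] (fun y => phi x - phi y).
  apply: measurable_funB; first exact: measurable_cst.
  by apply: continuous_measurable_fun; exact: schwartz_continuous.
have i1 : intg (fun y => truncated_inv e (x - y) ^+ 2 * (phi x - phi y)).
  apply: (@integrable_mul_bounded _ _ _ _ _ _ (C + C)) => //; first exact: Lt.2.
  by move=> y; apply: le_trans (ler_normB _ _) (lerD (hC x) (hC y)).
have i2 := L2_integrableM Lt Lpsi.
rewrite truncated_hilbertE.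
have -> : \int[mu]_(y in [set y | e < `|x - y|]) ((phi x - phi y) / `|x - y| ^+ 2) =
    \int[mu]_y (truncated_inv e (x - y) ^+ 2 * (phi x - phi y)).
  rewrite Rintegral_mkcond; apply: eq_Rintegral => y _.
  rewrite patchE /truncated_inv; case: ifPn => [|/negP xy].
    by rewrite inE/= => ->; rewrite real_normK ?num_real// exprVn mulrC.
  by rewrite ifF ?expr0n ?mul0r//; apply/negP => h; apply: xy; rewrite inE.
apply/eqP; rewrite -subr_eq -RintegralBT//; apply/eqP.
pose h y := (phi x - phi y) / (x - y) ^+ 2 - (derive1 phi) y / (x - y).
pose F y := (phi x - phi y) / (x - y).
pose D := [set y | e < `|x - y|].
have mD : measurable (D : set (measurableTypeR R)).
  have -> : D = (fun y => `|x - y|) @^-1` `]e, +oo[%classic.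
    by apply/seteqP; split => y /=; rewrite /D /= in_itv/= andbT.
  rewrite -[X in measurable X]setTI.
  have mn : measurable_fun [set: R] (fun y => `|x - y|).
    by apply: continuous_measurable_fun => y; apply: cvg_norm; apply: cvgB; [exact: cvg_cst|exact: cvg_id].
  exact: mn.
have hD : (fun y => truncated_inv e (x - y) ^+ 2 * (phi x - phi y) -
    truncated_inv e (x - y) * (derive1 phi) y) = h \_ D.
  apply/funext => y; rewrite patchE /truncated_inv; case: ifPn => xy.
    by rewrite mem_set// /h exprVn; ring.
  by rewrite memNset ?expr0n/= ?mul0r ?subr0//; exact/negP.
have ihD : intg (h \_ D) by rewrite -hD; exact: integrableBT.
have ih : mu.-integrable D (EFin \o h).
  by move: ihD; rewrite -restrict_EFin => /(integrable_mkcond _ mD).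
rewrite hD.
(* Centred at [x], so that removing the excised interval leaves two segments as soon as n > e. *)
pose A n := `[x - n%:R, x + n%:R]%classic : set R.
have c : \int[mu]_(y in A n) (h \_ D) y @[n --> \oo] --> \int[mu]_y (h \_ D) y.
  apply: cvg_Rintegral_exhaust => //; first by move=> n; exact: measurable_itv.
  move=> y _; have := near_segment (y - x); apply: filterS => n.
  by rewrite /A /= !in_itv/= => /andP[h1 h2]; apply/andP; split; lra.
have dF y : y != x -> is_derive y 1 F (h y).
  move=> yx; have xy : x - y != 0 by rewrite subr_eq0 eq_sym.
  have d1 := is_derive1_funB (is_derive1_cst (phi x) y) (schwartz_is_derive y sphi).
  have d2 := @is_derive1_funV R (fun y => x - y) y _ xy (is_derive1_subl x y).
  apply: is_derive_eq (is_derive1_funM d1 d2) _.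
  by rewrite /h; field.
have ch y : y != x -> {for y, continuous h}.
  move=> yx; have xy : x - y != 0 by rewrite subr_eq0 eq_sym.
  apply: cvgB; apply: cvgM.
  - by apply: cvgB; [exact: cvg_cst|exact: schwartz_continuous].
  - apply: cvgV; first by rewrite expf_neq0.
    by apply: cvg_sqr; apply: cvgB; [exact: cvg_cst|exact: cvg_id].
  - exact: schwartz_continuous_derive.
  - by apply: cvgV => //; apply: cvgB; [exact: cvg_cst|exact: cvg_id].
have AE n : e < n%:R -> \int[mu]_(y in A n) (h \_ D) y =
    (F (x - e) - F (x - n%:R)) + (F (x + n%:R) - F (x + e)).
  move=> en; rewrite -Rintegral_mkcondr.
  have AD : A n `&` D = `[x - n%:R, x - e[ `|` `]x + e, x + n%:R].
    rewrite /A /D; apply/seteqP; split => y /=; rewrite !in_itv/= ltr_normr.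
      by move=> [/andP[h1 h2] /orP[h3|h3]]; [left|right]; apply/andP; split; lra.
    move=> [|] /andP[h1 h2]; split.
    - by apply/andP; split; lra.
    - by apply/orP; left; lra.
    - by apply/andP; split; lra.
    - by apply/orP; right; lra.
  have [iL IL] : mu.-integrable `[x - n%:R, x - e] (EFin \o h) /\
      \int[mu]_(y in `[x - n%:R, x - e]) h y = F (x - e) - F (x - n%:R).
    apply: FTC_segment; first by lra.
      by move=> y /andP[_ h2]; apply: ch; rewrite lt_eqF//; lra.
    by move=> y /andP[_ h2]; apply: dF; rewrite lt_eqF//; lra.
  have [iR IR] : mu.-integrable `[x + e, x + n%:R] (EFin \o h) /\
      \int[mu]_(y in `[x + e, x + n%:R]) h y = F (x + n%:R) - F (x + e).
    apply: FTC_segment; first by lra.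
      by move=> y /andP[h2 _]; apply: ch; rewrite gt_eqF//; lra.
    by move=> y /andP[h2 _]; apply: dF; rewrite gt_eqF//; lra.
  rewrite AD Rintegral_setU//.
  - rewrite Rintegral_itv_bndo_bndc; last first.
      by apply: integrableS iL => //; apply: subset_itvl; rewrite bnd_simp.
    rewrite Rintegral_itv_obnd_cbnd; last first.
      by apply: integrableS iR => //; apply: subset_itvr; rewrite bnd_simp.
    by rewrite IL IR.
  - rewrite -AD; apply: integrableS ih => //; apply: measurableI => //; exact: measurable_itv.
  - apply/disj_setPS => y [] /=; rewrite !in_itv/= => /andP[_ h1] /andP[h2 _]; lra.
(* Both ends at once, with s = 1 and s = -1. *)
have Fn (s : R) : s != 0 -> F (x + s * n%:R) @[n --> \oo] --> 0.
  move=> s0; apply/cvgr0Pnorm_le => eps eps0; near=> n.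
  have n0 : 0 < n%:R :> R by rewrite ltr0n; near: n; exact: nbhs_infty_gt.
  have sn : 0 < `|s| * n%:R by rewrite mulr_gt0// normr_gt0.
  rewrite /F opprD addNKr normrM normfV normrN normrM [in X in _ / X](gtr0_norm n0).
  rewrite ler_pdivrMr//; apply: le_trans (ler_normB _ _) _.
  apply: le_trans (lerD (hC x) (hC _)) _.
  rewrite mulrA -ler_pdivrMl; last by rewrite mulr_gt0// normr_gt0.
  by near: n; exact: nbhs_infty_ger.
apply: (cvg_unique _ c) => //.
have c2 : F (x - e) - F (x + (-1) * n%:R) + (F (x + 1 * n%:R) - F (x + e)) @[n --> \oo] -->
   F (x - e) - 0 + (0 - F (x + e)).
  by apply: cvgD; apply: cvgB; (try exact: cvg_cst); apply: Fn; rewrite ?oppr_eq0 oner_eq0.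
have -> : (phi x - phi (x + e)) / e + (phi x - phi (x - e)) / e = F (x - e) - 0 + (0 - F (x + e)).
  by rewrite /F !opprD !addNKr opprK; field; exact: lt0r_neq0.
rewrite /=; apply: cvg_trans c2; apply: near_eq_cvg; near=> n; rewrite mulN1r mul1r -AE//.
by near: n; exact: nbhs_infty_gtr.
Unshelve. all: by end_near. Qed.

Lemma half_laplacian_lim phi x l : is_schwartz phi ->
  \int[mu]_(y in [set y | e < `|x - y|]) (derive1 phi y / (x - y)) @[e --> 0^'+] --> l ->
  half_laplacian phi x = fractional_const 2^-1 * l.
Proof.
move=> sphi c; rewrite /half_laplacian; congr (_ * _); rewrite /pv_integral.
apply/cvg_lim => //; rewrite -[X in _ --> X]add0r.
apply: cvg_trans (cvgD (cvg_schwartz_quotient x sphi) c).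
apply: near_eq_cvg; near=> e.
rewrite half_laplacian_by_parts//; by near: e; exact: nbhs_right_gt.
Unshelve. all: by end_near. Qed.
End schwartz.

(** * The constant of the half-Laplacian *)

Section fractional_constant.
Context {R : realType}.
Local Notation mu := (@lebesgue_measure R).
Local Notation intg f := (mu.-integrable [set: R] (EFin \o f)).

Lemma Euler_integral1 : Euler_integral (1 : R) = 1.
Proof.
rewrite /Euler_integral.
have -> : \int[mu]_(t in `]0, +oo[) (t `^ (1 - 1) * expR (- t)) =
    \int[mu]_(t in `]0, +oo[) expR (- t).
  by apply: eq_Rintegral => t _; rewrite subrr powRr0 mul1r.
have cE : continuous (fun t : R => expR (- t)).
  by move=> t; apply: continuous_comp; [exact: opp_continuous|exact: continuous_expR].
have mE : measurable_fun [set: R] (fun t : R => expR (- t)) by exact: continuous_measurable_fun.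
have dE (t : R) : is_derive t 1 (fun t : R => - expR (- t)) (expR (- t)).
  have d1 := is_derive1_funB (is_derive1_cst 0 t) (is_derive1_id t).
  have d2 := @is_derive1_fun_comp R (@expR R) (fun t => 0 - t) t _ _ (is_derive_expR _) d1.
  have := is_derive1_funB (is_derive1_cst 0 t) d2.
  under eq_fun do rewrite sub0r sub0r.
  by move=> d3; apply: is_derive_eq d3 _; rewrite !sub0r; ring.
rewrite /Rintegral integral_itv_obnd_cbnd; last first.
  by apply/measurable_EFinP; exact: measurable_funTS.
rewrite (@ge0_continuous_FTC2y _ _ (fun t => - expR (- t)) _ 0).
- by rewrite oppr0 expR0 /= sub0r opprK.
- by move=> t _; exact: expR_ge0.
- exact: continuous_subspaceT.
- by rewrite -[X in _ --> X]oppr0; apply: cvgN; exact: cvgr_expR.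
- by move=> t _; have [] := dE t.
- by apply: cvg_at_right_filter; apply: cvgN; exact: cE.
- by move=> t _; rewrite derive1E; have [_ ->] := dE t.
Qed.

(** The endpoint [a] is positive to stay away from 0, where the Euler integrand at 1/2 is
    singular. *)
Lemma substitution_sqr (G : R -> R) (a b : R) : 0 < a -> a < b ->
  (forall t, a ^+ 2 <= t <= b ^+ 2 -> {for t, continuous G}) ->
  \int[mu]_(t in `[a ^+ 2, b ^+ 2]) G t = \int[mu]_(s in `[a, b]) (G (s ^+ 2) * (2 * s)).
Proof.
move=> a0 ab cG; pose F (s : R) := s ^+ 2.
have dF (s : R) : is_derive s 1 F (2 * s).
  by apply: is_derive_eq (is_derive1_fun_sqr (is_derive1_id s)) _; rewrite mulr1.
have F'E : derive1 F = (fun s => 2 * s).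
  by apply/funext => s; rewrite derive1E; have [_ ->] := dF s.
have cF : continuous F by move=> s; exact: exprn_continuous.
have cF' : continuous (fun s : R => 2 * s).
  by move=> s; apply: cvgM; [exact: cvg_cst|exact: cvg_id].
rewrite /Rintegral (@integration_by_substitution_increasing _ F G a b)//.
- by congr fine; apply: eq_integral => s _; rewrite F'E.
- exact: ltW.
- move=> x y; rewrite !in_itv/= => /andP[ax _] /andP[ay _] xy.
  by rewrite /F ltr_pXn2r// nnegrE; apply: ltW; apply: lt_le_trans a0 _.
- by rewrite F'E => s _; exact: cF'.
- by rewrite F'E; apply/cvg_ex; exists (2 * a); apply: cvg_at_right_filter; exact: cF'.
- by rewrite F'E; apply/cvg_ex; exists (2 * b); apply: cvg_at_left_filter; exact: cF'.
- split; first by move=> s _; have [] := dF s.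
  + by apply: cvg_at_right_filter; exact: cF.
  + by apply: cvg_at_left_filter; exact: cF.
- by apply: continuous_in_subspaceT => t; rewrite inE/= in_itv/=; exact: cG.
Qed.

(** The substitution t = s^2 turns the integral into twice the Gaussian integral over the half-line.
    It is carried out on segments exhausting the half-line, since the integrand is singular at 0 and
    the domain unbounded. *)
Lemma Euler_integral_half : Euler_integral (2^-1 : R) = Num.sqrt pi.
Proof.
rewrite /Euler_integral.
pose G (t : R) := t `^ (2^-1 - 1) * expR (- t).
pose P : set R := `]0, +oo[%classic.
have mP : measurable (P : set (measurableTypeR R)) by exact: measurable_itv.
have PE t : P t = (0 < t) :> Prop by rewrite /P /= in_itv/= andbT.
have G0 t : 0 <= G t by rewrite mulr_ge0 ?powR_ge0 ?expR_ge0.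
have cG t : 0 < t -> {for t, continuous G}.
  move=> t0; have t0' : t \in `]0, +oo[ by rewrite in_itv/= t0.
  have cp : {for t, continuous (fun t : R => t `^ (2^-1 - 1))}.
    exact/differentiable_continuous/derivable1_diffP/(derivable_powR t0').
  apply: cvgM; first exact: cp.
  by apply: continuous_comp; [exact: opp_continuous|exact: continuous_expR].
have GE s : 0 < s -> G (s ^+ 2) * (2 * s) = 2 * gauss_fun s.
  move=> s0; rewrite /G /gauss_fun (_ : 2^-1 - 1 = - 2^-1); last by field.
  rewrite powRN powR12_sqrt ?sqr_ge0// sqrtr_sqr gtr0_norm//.
  by field; rewrite gt_eqF.
(* [n.+2] makes [a n < b n] hold already for n = 0. *)
pose a n : R := n.+1%:R^-1; pose b n : R := n.+2%:R.
have a0 n : 0 < a n by rewrite invr_gt0.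
have ab n : a n < b n.
  rewrite /a /b; apply: (@le_lt_trans _ _ 1); last by rewrite ltr1n.
  by rewrite invf_le1 ?ler1n.
pose g (s : R) := 2 * gauss_fun s.
have ig : intg g by apply: integrableZT; exact: integrableT_gauss.
have near_ab x : 0 < x -> \forall n \near \oo, a n <= x /\ x <= b n.
  move=> x0; near=> n; split.
    by near: n; apply: (cvgr_le _ cvg_harmonicV).
  have : x <= n%:R by near: n; exact: nbhs_infty_ger.
  by move=> /le_trans; apply; rewrite ler_nat -addn2 leq_addr.
have iP f (B : set R) : (B `<=` P) -> \int[mu]_(x in B) (f \_ P) x = \int[mu]_(x in B) f x.
  by move=> BP; rewrite -Rintegral_mkcondr setIidl.
have c1 : \int[mu]_(x in `[a n, b n]) (g \_ P) x @[n --> \oo] --> \int[mu]_x (g \_ P) x.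
  apply: cvg_Rintegral_exhaust.
  - by rewrite -restrict_EFin; apply/(integrable_mkcond _ mP); exact: integrableS ig.
  - by move=> n; exact: measurable_itv.
  - move=> x; rewrite patchE; case: ifPn => [|_]; last by rewrite eqxx.
    by rewrite inE PE => x0 _; apply: filterS (near_ab x x0) => n [? ?]; rewrite /= in_itv/=; apply/andP.
have gP : \int[mu]_x (g \_ P) x = Num.sqrt pi.
  rewrite -Rintegral_mkcond RintegralZl//; last first.
    by apply: integrableS integrableT_gauss => //; exact: measurable_itv.
  rewrite Rintegral_itv_obnd_cbnd; last first.
    by apply: integrableS integrableT_gauss => //; exact: measurable_itv.
  by rewrite /Rintegral integral0y_gauss /=; field.
have sub n : \int[mu]_(t in `[a n ^+ 2, b n ^+ 2]) (G \_ P) t = \int[mu]_(x in `[a n, b n]) (g \_ P) x.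
  rewrite iP; last by move=> t; rewrite PE /= in_itv/= => /andP[h _]; rewrite (lt_le_trans _ h) ?exprn_gt0.
  rewrite iP; last by move=> t; rewrite PE /= in_itv/= => /andP[h _]; rewrite (lt_le_trans _ h).
  rewrite substitution_sqr//; last first.
    by move=> t /andP[h _]; apply: cG; rewrite (lt_le_trans _ h) ?exprn_gt0.
  apply: eq_Rintegral => s; rewrite inE/= in_itv/= => /andP[h _]; rewrite GE//.
  by rewrite (lt_le_trans _ h).
have eP x : (G \_ P) x != 0 -> \forall n \near \oo, `[a n ^+ 2, b n ^+ 2]%classic x.
  rewrite patchE; case: ifPn => [|_]; last by rewrite eqxx.
  rewrite inE PE => x0 _; have sx : 0 < Num.sqrt x by rewrite sqrtr_gt0.
  apply: filterS (near_ab _ sx) => n [h1 h2].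
  rewrite /= in_itv/= -(sqr_sqrtr (ltW x0)); apply/andP; split; apply: lerXn2r => //; rewrite nnegrE ?sqrtr_ge0// ltW//.
(* By [sub] the integrals over the segments converge, hence are eventually bounded, which suffices
   for a nonnegative function. *)
have iG : intg (G \_ P).
  apply: (@integrable_exhaust _ _ _ mu (G \_ P) (fun n => `[a n ^+ 2, b n ^+ 2]%classic) (\int[mu]_x (g \_ P) x + 1)).
  - by move=> x; rewrite patchE; case: ifP.
  - by move=> n; exact: measurable_itv.
  - exact: eP.
  - move=> n.
    have an : a n ^+ 2 < b n ^+ 2 by rewrite ltr_pXn2r// ?nnegrE ?ab// ltW// (lt_trans (a0 n)).
    have iGn : mu.-integrable `[a n ^+ 2, b n ^+ 2] (EFin \o G).
      apply: continuous_compact_integrable; first exact: segment_compact.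
      apply: continuous_in_subspaceT => t; rewrite inE/= in_itv/= => /andP[h _].
      by apply: cG; rewrite (lt_le_trans _ h) ?exprn_gt0.
    apply: eq_integrable iGn => // t; rewrite inE/= in_itv/= => /andP[h _].
    by rewrite patchE mem_set// PE (lt_le_trans _ h) ?exprn_gt0.
  - under eq_near do rewrite sub.
    by apply: (cvgr_le _ c1); rewrite ltrDl.
have c2 : \int[mu]_(x in `[a n ^+ 2, b n ^+ 2]) (G \_ P) x @[n --> \oo] --> \int[mu]_x (G \_ P) x.
  by apply: cvg_Rintegral_exhaust => // n; exact: measurable_itv.
rewrite Rintegral_mkcond -/G -gP.
move: c2; rewrite (funext sub) => c2.
exact: cvg_unique c2 c1.
Unshelve. all: by end_near. Qed.

(** Gamma(1) = 1 and Gamma(-1/2) = Gamma(1/2) / (-1/2) = -2 sqrt pi, so the constant is 2 / (sqrt pi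
    * 2 sqrt pi). *)
Lemma fractional_const_half : fractional_const (2^-1 : R) = pi^-1.
Proof.
rewrite /fractional_const /Gamma.
have h1 : 2^-1 + 2^-1 = 1 :> R by lra.
have h2 : - 2^-1 + 1 = 2^-1 :> R by lra.
(* Hence the extension of Euler's integral takes exactly one step at -1/2. *)
have h3 : Num.truncn (2^-1 : R) = 0%N by apply/truncn0Pn; rewrite -ltNge invf_lt1// ltr1n.
rewrite h1 ltr01 big_ord0 addr0 divr1 Euler_integral1.
rewrite opprK h3 ltNge oppr_le0 invr_ge0 ler0n/= big_ord1 addr0 h2 Euler_integral_half.
rewrite !powR12_sqrt ?pi_ge0//.
rewrite (_ : 4 = 2 ^+ 2 :> R); last by ring.
rewrite sqrtr_sqr gtr0_norm// mulr1.
have s0 : 0 < Num.sqrt pi :> R by rewrite sqrtr_gt0 pi_gt0.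
rewrite invrN invrK mulrN normrN gtr0_norm ?mulr_gt0//.
rewrite -[in RHS](sqr_sqrtr (pi_ge0 R)); move: (Num.sqrt pi) s0 => s s0.
by field; rewrite gt_eqF.
Qed.
End fractional_constant.

(** * The identity in the sense of distributions *)

Lemma Lfun2_L2 {R : realType} (u : R -> R) : u \in Lfun (@lebesgue_measure R) 2%:E ->
  L2 (@lebesgue_measure R) u.
Proof.
by move=> hu; split; [move: hu; rewrite inE => /andP[]; rewrite inE|exact: Lfun2_integrable_sqr].
Qed.

Unset Implicit Arguments.

Theorem theorem2p1 (R : realType) (u : R -> R)
    (hu : u \in Lfun (@lebesgue_measure R) 2%:E)
    (hLu : is_tempered_distribution (half_laplacian_distribution u)) :
  distribution_eq
    (distribution_derive (distribution_of (hilbert_transform u)))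
    (half_laplacian_distribution u).
Proof.
move=> phi sphi; have Lu := Lfun2_L2 hu.
have [ipsi Lpsi] := schwartz_derive_integrable sphi.
have [gu [Lgu ugu aeu]] := truncated_hilbert_ae Lu.
have [gp [Lgp pgp aep]] := truncated_hilbert_ae Lpsi.
rewrite /distribution_derive /distribution_of /half_laplacian_distribution.
(* The Hilbert transform agrees with [gu] / pi only almost everywhere, its other values being those
   of a total limit. *)
have -> : \int[lebesgue_measure]_x (hilbert_transform u x * derive1 phi x) =
    \int[lebesgue_measure]_x (pi^-1 * (derive1 phi x * gu x)).
  apply: ae_eq_Rintegral; apply: aeS aeu => x cx.
  by rewrite /hilbert_transform /pv_integral (cvg_lim _ cx)// mulrCA mulrC mulrA.
(* The same factor 1 / pi appears, now from the constant of the half-Laplacian, so that antisymmetry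
   alone remains; its sign cancels that of the distributional derivative. *)
have -> : \int[lebesgue_measure]_x (u x * half_laplacian phi x) =
    \int[lebesgue_measure]_x (pi^-1 * (u x * gp x)).
  apply: ae_eq_Rintegral; apply: aeS aep => x cx.
  by rewrite (half_laplacian_lim sphi cx) fractional_const_half mulrCA.
rewrite !RintegralZT; [|exact: L2_integrableM..].
by rewrite (conj_poisson_limit_antisym ipsi Lpsi Lu Lgp Lgu pgp ugu) mulrN opprK.
Qed.
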